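(* Let $T$ be an o-minimal theory with monster model $\mathbb{M}$ such that $\mathrm{dcl}(A)=\bigcup_{a\in A}\mathrm{dcl}(a)$ for every non-empty set $A\subseteq\mathbb{M}$. If $(\mathbb{M},\mathbb{P})$ is the monster model of the theory $T_P$ of lovely pairs of models of $T$, then $o(\mathbb{P})=e(\mathbb{P})$.
   Context: Conventions. $T$ is a complete first-order theory in a language $L$ with an infinite model. Fix a strongly inaccessible cardinal $\lambda>|L|$; the monster model of a complete theory is its saturated model of cardinality $\lambda$ (unique up to isomorphism), and ''small'' means of cardinality $<\lambda$. For $\mathbb{D}\subseteq\mathbb{M}$, $(\mathbb{M},\mathbb{D})$ is the expansion of $\mathbb{M}$ by a new predicate interpreted as $\mathbb{D}$, and $o(\mathbb{D})=\{\mathbb{D}'\subseteq\mathbb{M}\mid(\mathbb{M},\mathbb{D})\cong(\mathbb{M},\mathbb{D}')\}=\{f(\mathbb{D})\mid f\in\mathrm{Aut}(\mathbb{M})\}$, $e(\mathbb{D})=\{\mathbb{D}'\subseteq\mathbb{M}\mid(\mathbb{M},\mathbb{D})\equiv(\mathbb{M},\mathbb{D}')\}$. An o-minimal theory is the complete theory of a densely ordered o-minimal structure; in such a theory $\mathrm{dcl}=\mathrm{acl}$, and o-minimal theories are geometric ($\mathrm{acl}$ satisfies exchange in models of $T$ and $T$ eliminates $\exists^\infty$). Lovely pairs. Let $T$ be geometric and $L_P=L\cup\{P\}$ with $P$ a new unary predicate. An $L_P$-structure $(M,P(M))$ with $M\models T$ is a lovely pair of $T$ if $P(M)\preceq M$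 in $L$ and: (Coheir/density) for every finite $A\subseteq M$, every non-algebraic $L$-type $q(x)\in S_1(A)$ has a realization in $P(M)$; (Extension) for every finite $A\subseteq M$, every non-algebraic $L$-type $q(x)\in S_1(A)$ has a realization $a\in M$ with $a\notin\mathrm{acl}(A\cup P(M))$. Here $\mathrm{acl}$ is in the sense of $L$. All lovely pairs of $T$ are elementarily equivalent; their common complete theory is denoted $T_P$ (the theory of lovely pairs of $T$). It is axiomatized by $T$ together with: $P$ is an $L$-elementary substructure; if $\varphi(\bar a,x)$ ($\varphi\in L$) has infinitely many solutions, it has a solution in $P$; if $\varphi(\bar a,x)$ has infinitely many solutions and, for every $\bar y$, $\psi(\bar a,\bar y,x)$ has fewer than $k$ solutions, then some solution $x$ of $\varphi(\bar a,x)$ satisfies $\neg\psi(\bar a,\bar y,x)$ for all $\bar y$ from $P$ ($\varphi,\psi\in L$). Every $\omega$-saturated model of $T_P$ is a lovely pair. The $L$-reduct of the monster model of $T_P$ is identified with $\mathbb{M}$, and $\mathbb{P}=P(\mathbb{M})$. *)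

(* Defs.v *)
From mathcomp Require Import all_boot.
From mathcomp Require Import boolp classical_sets functions cardinality.

Set Implicit Arguments.
Unset Strict Implicit.
Unset Printing Implicit Defensive.

Local Open Scope classical_set_scope.
Local Open Scope card_scope.

(** * Cardinals, represented by types *)

Definition card_lt T U (A : set T) (B : set U) : Prop :=
  A #<= B /\ ~ (B #<= A).

(* Cardinals below that of [Lam] are those of the subsets of [Lam] that are
   strictly smaller than [Lam]. *)
Definition strongly_inaccessible (Lam : Type) : Prop :=
  [/\ card_lt [set: nat] [set: Lam],
      forall (I : set Lam) (F : Lam -> set Lam),
        card_lt I [set: Lam] ->
        (forall i, I i -> card_lt (F i) [set: Lam]) ->
        card_lt (\bigcup_(i in I) F i) [set: Lam]
    & forall A : set Lam, card_lt A [set: Lam] ->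
        card_lt [set B : set Lam | B `<=` A] [set: Lam]].

(** * First-order logic with equality *)

(* Symbols of arity [n] are [fsym L n] and [rsym L n]; constants have arity 0. *)
Record language := Language {
  fsym : nat -> Type;
  rsym : nat -> Type
}.

Definition symbols (L : language) : Type :=
  ({n & fsym L n} + {n & rsym L n})%type.

(* [term L n] and [formula L n] have their free variables in ['I_n].  The
   quantifier binds variable [ord0] of its body, the outer variable [i] being
   [lift ord0 i] there. *)
Inductive term (L : language) (n : nat) : Type :=
| TVar of 'I_n
| TFun k of fsym L k & ('I_k -> term L n).

Inductive formula (L : language) : nat -> Type :=
| FBot n : formula L n
| FEq n of term L n & term L n : formula L n
| FRel n k of rsym L k & ('I_k -> term L n) : formula L n
| FImp n of formula L n & formula L n : formula L n
| FAll n of formula L n.+1 : formula L n.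

Definition FNot L n (phi : formula L n) : formula L n := FImp phi (FBot L n).

Notation sentence L := (formula L 0).

(* Empty structures are not excluded: they are never models of a complete theory
   that has an infinite model. *)
Record structure (L : language) := Structure {
  carrier :> Type;
  finterp : forall n, fsym L n -> ('I_n -> carrier) -> carrier;
  rinterp : forall n, rsym L n -> ('I_n -> carrier) -> Prop
}.

Definition env0 (T : Type) : 'I_0 -> T :=
  fun i => match notF (ltn_ord i) with end.

Definition scons (T : Type) n (a : T) (v : 'I_n -> T) : 'I_n.+1 -> T :=
  fun i => if unlift ord0 i is Some j then v j else a.

Fixpoint eval L (M : structure L) n (v : 'I_n -> M) (t : term L n) : M :=
  match t with
  | TVar i => v i
  | TFun _ f ts => finterp f (fun i => eval v (ts i))
  end.

Fixpoint sat L (M : structure L) n (phi : formula L n) : ('I_n -> M) -> Prop :=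
  match phi in formula _ n return ('I_n -> M) -> Prop with
  | FBot _ => fun _ => False
  | FEq _ t u => fun v => eval v t = eval v u
  | FRel _ _ r ts => fun v => rinterp r (fun i => eval v (ts i))
  | FImp _ phi1 phi2 => fun v => sat phi1 v -> sat phi2 v
  | FAll _ phi1 => fun v => forall a : M, sat phi1 (scons a v)
  end.

Definition holds L (M : structure L) (s : sentence L) : Prop :=
  sat s (@env0 M).

Definition Th L (M : structure L) : set (sentence L) := [set s | holds M s].

Definition model L (T : set (sentence L)) (M : structure L) : Prop :=
  forall s, T s -> holds M s.

Definition has_infinite_model L (T : set (sentence L)) : Prop :=
  exists M : structure L, model T M /\ infinite_set [set: M].

Definition elem_equiv L (M N : structure L) : Prop := Th M = Th N.

Definition isomorphism L (M N : structure L) (h : M -> N) : Prop :=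
  [/\ bijective h,
      forall n (f : fsym L n) (v : 'I_n -> M),
        h (finterp f v) = finterp f (h \o v)
    & forall n (r : rsym L n) (v : 'I_n -> M),
        rinterp r v <-> rinterp r (h \o v)].

Definition isomorphic L (M N : structure L) : Prop :=
  exists h : M -> N, isomorphism h.

Definition closed_under_functions L (M : structure L) (A : set M) : Prop :=
  forall n (f : fsym L n) (v : 'I_n -> M),
    (forall i, A (v i)) -> A (finterp f v).

Definition substructure L (M : structure L) (A : set M)
    (hA : closed_under_functions A) : structure L :=
  @Structure L (set_type A)
    (fun n f v => exist (fun x => x \in A) (finterp f (fun i => val (v i)))
       (mem_set (hA n f (fun i => val (v i)) (fun i => set_valP (v i)))))
    (fun n r v => rinterp r (fun i => val (v i))).

Definition elementary_substructure L (M : structure L) (A : set M) : Prop :=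
  exists hA : closed_under_functions A,
    forall n (phi : formula L n) (v : 'I_n -> substructure hA),
      sat phi v <-> sat phi (fun i => val (v i) : M).

(** * Definable sets, closure operators and types over parameters *)

(* A formula phi(x, b) in one variable x with a tuple b of parameters from [M];
   x is variable [ord0] of phi. *)
Record pformula L (M : structure L) := PFormula {
  arity_par : nat;
  form : formula L arity_par.+1;
  par : 'I_arity_par -> M
}.
Arguments par [L M] p _.

Definition over L (M : structure L) (A : set M) (phi : pformula M) : Prop :=
  forall i, A (par phi i).

Definition solutions L (M : structure L) (phi : pformula M) : set M :=
  [set x | sat (form phi) (scons x (par phi))].

Definition pnot L (M : structure L) (phi : pformula M) : pformula M :=
  PFormula (FNot (form phi)) (par phi).

Definition dcl L (M : structure L) (A : set M) : set M :=
  [set b | exists phi, over A phi /\ solutions phi = [set b]].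

Definition acl L (M : structure L) (A : set M) : set M :=
  [set b | exists phi, [/\ over A phi, finite_set (solutions phi)
                         & solutions phi b]].

Definition realizes L (M : structure L) (p : set (pformula M)) (a : M) : Prop :=
  forall phi, p phi -> solutions phi a.

(* Membership of [p] in S_1(A); consistency with the elementary diagram is
   finite satisfiability in [M]. *)
Definition type_over L (M : structure L) (A : set M)
    (p : set (pformula M)) : Prop :=
  [/\ p `<=` over A,
      forall q : set (pformula M), finite_set q -> q `<=` p ->
        exists a, realizes q a
    & forall phi, over A phi -> p phi \/ p (pnot phi)].

Definition nonalgebraic L (M : structure L) (p : set (pformula M)) : Prop :=
  forall phi, p phi -> infinite_set (solutions phi).

Definition saturated L (M : structure L) : Prop :=
  forall A : set M, card_lt A [set: M] -> forall p : set (pformula M),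
    type_over A p -> exists a, realizes p a.

(* [M] is the monster model of [T], for the cardinal of [Lam]. *)
Definition monster (Lam : Type) L (T : set (sentence L))
    (M : structure L) : Prop :=
  [/\ model T M, saturated M & [set: M] #= [set: Lam]].

(** * O-minimal theories *)

Definition ltM L (lt : rsym L 2) (M : structure L) (x y : M) : Prop :=
  rinterp lt (tnth [tuple x; y]).

Definition dense_linear_order L (lt : rsym L 2) (M : structure L) : Prop :=
  [/\ forall x : M, ~ ltM lt x x,
      forall x y z : M, ltM lt x y -> ltM lt y z -> ltM lt x z,
      forall x y : M, [\/ ltM lt x y, x = y | ltM lt y x]
    & forall x y : M, ltM lt x y -> exists z, ltM lt x z /\ ltM lt z y].

(* [None] is -oo as left endpoint [a] and +oo as right endpoint [b]. *)
Definition open_interval L (lt : rsym L 2) (M : structure L)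
    (a b : option M) : set M :=
  [set x | (if a is Some a' then ltM lt a' x else True) /\
           (if b is Some b' then ltM lt x b' else True)].

Definition point_or_interval L (lt : rsym L 2) (M : structure L) :
    set (set M) :=
  [set I | (exists a, I = [set a]) \/ (exists a b, I = open_interval lt a b)].

Definition o_minimal L (lt : rsym L 2) (M : structure L) : Prop :=
  dense_linear_order lt M /\
  forall phi : pformula M, exists F : set (set M),
    [/\ finite_set F, F `<=` @point_or_interval L lt M
      & solutions phi = \bigcup_(I in F) I].

Definition o_minimal_theory L (lt : rsym L 2) (T : set (sentence L)) : Prop :=
  exists M : structure L, o_minimal lt M /\ T = Th M.

(** * Expansions by a unary predicate, and lovely pairs *)

Inductive rsymP (L : language) : nat -> Type :=
| OldR n of rsym L n : rsymP L n
| PredP : rsymP L 1.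

Definition langP (L : language) : language := Language (fsym L) (rsymP L).

Definition expand L (M : structure L) (D : set M) : structure (langP L) :=
  @Structure (langP L) M (@finterp L M)
    (fun n r => match r in rsymP _ n return ('I_n -> M) -> Prop with
                | OldR _ r' => rinterp r'
                | PredP => fun v => D (v ord0)
                end).

(* o(D) *)
Definition iso_class L (M : structure L) (D : set M) : set (set M) :=
  [set D' | isomorphic (expand D) (expand D')].

(* e(D) *)
Definition elem_class L (M : structure L) (D : set M) : set (set M) :=
  [set D' | elem_equiv (expand D) (expand D')].

(* Every [langP L]-structure is [expand P] for its [L]-reduct [M] and the
   interpretation [P] of the new predicate. *)
Definition lovely_pair L (T : set (sentence L)) (M : structure L) (P : set M) :
    Prop :=
  [/\ model T M,
      elementary_substructure P,
      forall (A : set M) (q : set (pformula M)),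
        finite_set A -> type_over A q -> nonalgebraic q ->
        exists2 a, realizes q a & P a
    & forall (A : set M) (q : set (pformula M)),
        finite_set A -> type_over A q -> nonalgebraic q ->
        exists2 a, realizes q a & ~ acl (A `|` P) a].

(* The theory T_P: the sentences common to all lovely pairs of [T]. *)
Definition lovely_theory L (T : set (sentence L)) : set (sentence (langP L)) :=
  [set s | forall (M : structure L) (P : set M),
             lovely_pair T P -> holds (expand P) s].

(* Main.v *)
(* Let D be such that (M, D) is elementarily equivalent to (M, P). Then D,
   like P, is dense and codense and closed under 0-definable unary functions,
   and (M, P) and (M, D) are shown to be isomorphic by a back and forth
   between small elementary partial maps respecting the predicates. This needs
   that the set of realizations of a non-algebraic type over a small set A
   contains an interval. Instead of the theorem that o-minimality is preserved
   by elementary equivalence, this uses triviality as follows. If b is a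
   boundary point of an A-definable set, then b is in dcl(A, u) for every u in
   some interval next to b. So if b is not in dcl(A), triviality puts b in
   dcl(u) for all these u, and by saturation one 0-definable unary function
   takes the constant value b on an interval. The set Y of all values that
   this function takes on an interval contains no interval: otherwise Y would
   have a point y outside P by codensity, and y would be the value at some
   point of P by density. Being 0-definable, Y is then finite, so b is in
   dcl(0) after all. The same property of Y gives exchange. *)
From Stdlib Require Inverse_Image.
From mathcomp Require Import all_boot.
From mathcomp Require Import boolp classical_sets functions cardinality filter
  wochoice.
Require Import Defs.

Set Implicit Arguments.
Unset Strict Implicit.
Unset Printing Implicit Defensive.

Local Open Scope classical_set_scope.
Local Open Scope card_scope.

(** * Uniformly definable relations *)

Lemma scons0 T n (a : T) (v : 'I_n -> T) : scons a v ord0 = a.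
Proof. by rewrite /scons unlift_none. Qed.

Lemma sconsS T n (a : T) (v : 'I_n -> T) i : scons a v (lift ord0 i) = v i.
Proof. by rewrite /scons liftK. Qed.

Lemma scons_tail T n (a : T) (v : 'I_n -> T) :
  (fun i => scons a v (lift ord0 i)) = v.
Proof. by apply/funext => i; rewrite sconsS. Qed.

Lemma scons_comp T U n (h : T -> U) (a : T) (v : 'I_n -> T) :
  (fun i => h (scons a v i)) = scons (h a) (fun i => h (v i)).
Proof. by apply/funext => i; rewrite /scons; case: unlift. Qed.

Lemma scons_eta T n (w : 'I_n.+1 -> T) :
  scons (w ord0) (fun i => w (lift ord0 i)) = w.
Proof.
apply/funext => i; have [j ->|->] := unliftP ord0 i; first by rewrite sconsS.
by rewrite scons0.
Qed.

Lemma env0_eq T (v w : 'I_0 -> T) : v = w.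
Proof. by apply/funext => -[]. Qed.

Fixpoint trename L n m (r : 'I_n -> 'I_m) (t : term L n) : term L m :=
  match t with
  | TVar i => TVar L (r i)
  | TFun _ f ts => TFun f (fun i => trename r (ts i))
  end.

Definition up n m (r : 'I_n -> 'I_m) : 'I_n.+1 -> 'I_m.+1 :=
  scons ord0 (fun i => lift ord0 (r i)).

Lemma scons_up T n m (r : 'I_n -> 'I_m) (a : T) (v : 'I_m -> T) :
  (fun i => scons a v (up r i)) = scons a (fun i => v (r i)).
Proof.
rewrite /up scons_comp scons0.
by congr scons; apply/funext => i; rewrite sconsS.
Qed.

Fixpoint frename L n (phi : formula L n) :
    forall m, ('I_n -> 'I_m) -> formula L m :=
  match phi in formula _ n return forall m, ('I_n -> 'I_m) -> formula L m with
  | FBot _ => fun m _ => FBot L m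
  | FEq _ t u => fun m r => FEq (trename r t) (trename r u)
  | FRel _ _ s ts => fun m r => FRel s (fun i => trename r (ts i))
  | FImp _ p q => fun m r => FImp (frename p r) (frename q r)
  | FAll _ p => fun m r => FAll (frename p (up r))
  end.

Lemma eval_trename L (N : structure L) n m (r : 'I_n -> 'I_m) (v : 'I_m -> N)
    (t : term L n) :
  eval v (trename r t) = eval (fun i => v (r i)) t.
Proof.
by elim: t => //= k f ts IH; congr finterp; apply/funext => i; apply: IH.
Qed.

Lemma sat_frename L (N : structure L) n (phi : formula L n) :
  forall m (r : 'I_n -> 'I_m) (v : 'I_m -> N),
  sat (frename phi r) v <-> sat phi (fun i => v (r i)).
Proof.
elim: {n} phi => [n|n t u|n k s ts|n p IHp q IHq|n p IHp] m r v //=.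
- by rewrite !eval_trename.
- by under eq_fun do rewrite eval_trename.
- by rewrite IHp IHq.
- by split=> H a; have := H a; rewrite IHp scons_up.
Qed.

(** The relation is a family over all structures, so that a single formula defines it in both sides
    of a transfer. The closure lemmas below build that formula from a relation written in ordinary
    logic. *)
Definition definable L n (R : forall N : structure L, ('I_n -> N) -> Prop) :=
  exists phi : formula L n, forall (N : structure L) v, sat phi v <-> R N v.

Section Definability.
Context (L : language).
Implicit Types (n m : nat).

Lemma def_ext n (R S : forall N : structure L, ('I_n -> N) -> Prop) :
  definable R -> (forall N v, R N v <-> S N v) -> definable S.
Proof. by move=> [p Hp] H; exists p => N v; rewrite Hp H. Qed.

Lemma def_sat n (phi : formula L n) : definable (fun N v => @sat L N n phi v).
Proof. by exists phi. Qed.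

Lemma def_subst n m (R : forall N : structure L, ('I_n -> N) -> Prop)
    (r : 'I_n -> 'I_m) :
  definable R -> definable (fun N v => R N (fun i => v (r i))).
Proof. by case=> phi H; exists (frename phi r) => N v; rewrite sat_frename H. Qed.

Lemma def_sat_scons n m (phi : formula L n.+1) k (r : 'I_n -> 'I_m) :
  definable (fun N v => @sat L N n.+1 phi (scons (v k) (fun i => v (r i)))).
Proof.
apply: (def_ext (def_subst (scons k r) (def_sat phi))) => N v.
by rewrite scons_comp.
Qed.

Lemma def_False n : definable (fun (N : structure L) (v : 'I_n -> N) => False).
Proof. by exists (FBot L n). Qed.

Lemma def_imp n (R S : forall N : structure L, ('I_n -> N) -> Prop) :
  definable R -> definable S -> definable (fun N v => R N v -> S N v).
Proof.
by move=> [p Hp] [q Hq]; exists (FImp p q) => N v; rewrite -Hp -Hq.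
Qed.

Lemma def_all n (R : forall N : structure L, ('I_n -> N) -> N -> Prop) :
  definable (fun N (w : 'I_n.+1 -> N) => R N (fun i => w (lift ord0 i)) (w ord0)) ->
  definable (fun N v => forall a, R N v a).
Proof.
move=> [p Hp]; exists (FAll p) => N v /=.
by split=> H a; have := H a; rewrite Hp scons0;
   under eq_fun do rewrite sconsS.
Qed.

Lemma def_not n (R : forall N : structure L, ('I_n -> N) -> Prop) :
  definable R -> definable (fun N v => ~ R N v).
Proof. by move=> HR; apply: def_imp => //; apply: def_False. Qed.

Lemma def_and n (R S : forall N : structure L, ('I_n -> N) -> Prop) :
  definable R -> definable S -> definable (fun N v => R N v /\ S N v).
Proof.
move=> HR HS; apply: (def_ext (def_not (def_imp HR (def_not HS)))) => N v.
by split=> [H|[HR1 HS1] /(_ HR1)] //; split; apply: contrapT => H1; apply: H.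
Qed.

Lemma def_or n (R S : forall N : structure L, ('I_n -> N) -> Prop) :
  definable R -> definable S -> definable (fun N v => R N v \/ S N v).
Proof.
move=> HR HS; apply: (def_ext (def_imp (def_not HR) HS)) => N v.
by split=> [H|[]//]; have [|/H] := pselect (R N v); [left|right].
Qed.

Lemma def_iff n (R S : forall N : structure L, ('I_n -> N) -> Prop) :
  definable R -> definable S -> definable (fun N v => R N v <-> S N v).
Proof. by move=> HR HS; apply: def_and; apply: def_imp. Qed.

Lemma def_ex n (R : forall N : structure L, ('I_n -> N) -> N -> Prop) :
  definable (fun N (w : 'I_n.+1 -> N) => R N (fun i => w (lift ord0 i)) (w ord0)) ->
  definable (fun N v => exists a, R N v a).
Proof.
move=> HR; apply: (@def_ext _ (fun N v => ~ forall a, ~ R N v a)).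
  exact/def_not/def_all/def_not.
by move=> N v; split=> [/existsNP[a /contrapT]|[a Ra] /(_ a)]; first by exists a.
Qed.

Lemma def_eq n i j : definable (fun (N : structure L) (v : 'I_n -> N) => v i = v j).
Proof. by exists (FEq (TVar L i) (TVar L j)). Qed.

Lemma def_rel n k (s : rsym L k) (r : 'I_k -> 'I_n) :
  definable (fun (N : structure L) (v : 'I_n -> N) => rinterp s (fun i => v (r i))).
Proof. by exists (FRel s (fun i => TVar L (r i))). Qed.

Lemma def_lt n (lt : rsym L 2) i j :
  definable (fun (N : structure L) (v : 'I_n -> N) => ltM lt (v i) (v j)).
Proof.
apply: (def_ext (def_rel lt (tnth [tuple i; j]))) => N v.
rewrite /ltM; suff -> : (fun k => v (tnth [tuple i; j] k)) = tnth [tuple v i; v j] by [].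
apply/funext => k; rewrite !(tnth_nth (v i)) (tnth_nth i).
by case: k => -[|[|]].
Qed.

Lemma def_closure n (R : forall N : structure L, ('I_n -> N) -> Prop) :
  definable R ->
  exists s : sentence L, forall N, holds N s <-> forall v, R N v.
Proof.
elim: n R => [|n IHn] R HR.
  have [s Hs] := HR; exists s => N; rewrite /holds Hs; split=> // H v.
  by rewrite (env0_eq v (@env0 N)).
have [|s Hs] := IHn (fun N v => forall a, R N (scons a v)).
  by apply: def_all; apply: (def_ext HR) => N v; rewrite scons_eta.
exists s => N; rewrite Hs; split=> [H v|H v a]; last exact: H.
by rewrite -(scons_eta v).
Qed.

(** The converse direction holds because [Th M0] contains the negation of every sentence that fails
    in [M0]. *)
Lemma transfer (M0 N : structure L) n
    (R : forall N : structure L, ('I_n -> N) -> Prop) :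
  model (Th M0) N -> definable R ->
  (forall v, R M0 v) <-> (forall v, R N v).
Proof.
move=> MN /def_closure[s Hs]; rewrite -!Hs; split; first exact: MN.
move=> Ns; apply: contrapT => M0s; exact: (MN (FNot s)).
Qed.

End Definability.

Ltac definability :=
  repeat first
    [ apply: def_all | apply: def_ex | apply: def_and | apply: def_or
    | apply: def_not | apply: def_iff | apply: def_imp | apply: def_False
    | apply: def_lt | apply: def_eq
    | apply: def_sat_scons ].

Lemma dlo_transfer L (lt : rsym L 2) (M0 N : structure L) :
  model (Th M0) N -> dense_linear_order lt M0 -> dense_linear_order lt N.
Proof.
move=> MN [H1 H2 H3 H4].
have E (R : structure L -> Prop) :
    definable (fun N (_ : 'I_0 -> N) => R N) -> R M0 -> R N.
  move=> HR R0; have [H _] := transfer MN HR.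
  exact: (H (fun _ => R0) (@env0 N)).
split.
- apply: (E (fun N => forall x : N, ~ ltM lt x x)) => //; definability.
- apply: (E (fun N => forall x y z : N, ltM lt x y -> ltM lt y z -> ltM lt x z)) => //.
  definability.
- move=> x y.
  suff [|[|]] : ltM lt x y \/ x = y \/ ltM lt y x by constructor.
  move: x y; apply: (E (fun N => forall x y : N, ltM lt x y \/ x = y \/ ltM lt y x)).
    definability.
  by move=> x y; case: (H3 x y); auto.
- apply: (E (fun N => forall x y : N, ltM lt x y -> exists z, ltM lt x z /\ ltM lt z y)) => //.
  definability.
Qed.

(** * Consequences of o-minimality that transfer *)

(** Membership in a sequence is expressed through [has], because carriers of structures are bare
    types without decidable equality. *)
Lemma count_ltn (T : Type) (p q : pred T) f (s : seq T) :
  subpred p q -> has (fun t => `[< t = f >]) s -> q f -> ~~ p f ->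
  (count p s < count q s)%N.
Proof.
move=> pq fs qf pf; elim: s fs => //= t s IH /orP[/asboolP->|/IH {}IH].
  by rewrite qf (negPf pf) add0n add1n ltnS; apply: sub_count.
by rewrite -addnS leq_add //; case: (p t) (pq t) => // ->.
Qed.

Lemma has_witness (T : Type) (p : pred T) (s : seq T) :
  has p s -> exists2 f, has (fun t => `[< t = f >]) s & p f.
Proof.
elim: s => //= t s IH /orP[pt|/IH[f fs pf]]; first by exists t; rewrite ?asboolT.
by exists f; rewrite ?fs ?orbT.
Qed.

Section Order.
Context (L : language) (lt : rsym L 2) (N : structure L).
Hypothesis dlo : dense_linear_order lt N.
Local Notation "x <M y" := (ltM lt x y) (at level 70).
Implicit Types (x y z u v w : N) (X : set N) (s : seq N).

Lemma ltM_irr x : ~ x <M x. Proof. by case: dlo. Qed.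

Lemma ltM_trans y x z : x <M y -> y <M z -> x <M z.
Proof. by case: dlo => _ H _ _; apply: H. Qed.

Lemma ltM_asym x y : x <M y -> ~ y <M x.
Proof. by move=> xy yx; apply: (@ltM_irr x); apply: ltM_trans yx. Qed.

Lemma ltM_total x y : x <> y -> x <M y \/ y <M x.
Proof. by case: dlo => _ _ H _; case: (H x y); auto. Qed.

Lemma nltM x y : ~ x <M y -> y <M x \/ y = x.
Proof. by case: dlo => _ _ H _; case: (H x y); auto. Qed.

Lemma ltM_dense x y : x <M y -> exists z, x <M z /\ z <M y.
Proof. by case: dlo => _ _ _; apply. Qed.

Lemma ltM_le_trans y x z : x <M y -> ~ z <M y -> x <M z.
Proof. by move=> xy /nltM[|<-] //; apply: ltM_trans. Qed.

Lemma leM_lt_trans y x z : ~ y <M x -> y <M z -> x <M z.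
Proof. by move=> /nltM[|->] //; apply: ltM_trans. Qed.

Lemma leM_trans y x z : ~ y <M x -> ~ z <M y -> ~ z <M x.
Proof. by move=> /nltM[xy|->] // /(ltM_le_trans xy)/ltM_asym. Qed.

Definition avoids s x y := ~~ has (fun z => `[< ~ z <M x /\ ~ y <M z >]) s.

Lemma avoids_cat s1 s2 x y :
  avoids (s1 ++ s2) x y -> avoids s1 x y /\ avoids s2 x y.
Proof. by rewrite /avoids has_cat => /norP. Qed.

Lemma avoids1 a x y : avoids [:: a] x y -> x <M y -> a <M x \/ y <M a.
Proof.
rewrite /avoids /= orbF => /asboolPn H xy; apply: contrapT => H'; apply: H.
by split=> h; apply: H'; [left|right].
Qed.

(** Stands for being a finite union of points and intervals: membership in [X] changes only at
    points of the finite list [s]. In this form a finite union is handled by concatenating lists. *)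
Definition const_off s X :=
  forall x y, x <M y -> avoids s x y -> (X x <-> X y).

Lemma point_or_interval_const_off X :
  point_or_interval lt X -> exists s, const_off s X.
Proof.
case=> [[a ->]|[a [b ->]]].
  exists [:: a] => x y xy /avoids1 /(_ xy) H.
  by split=> /= e; move: H xy; rewrite e => -[] H H';
    [case: (ltM_irr H)|case: (ltM_asym H H')|case: (ltM_asym H H')|case: (ltM_irr H)].
exists ((if a is Some a' then [:: a'] else [::]) ++
        (if b is Some b' then [:: b'] else [::])) => x y xy /avoids_cat[Ha Hb].
rewrite /open_interval /=.
have Ea : (if a is Some a' then a' <M x else True) <->
          (if a is Some a' then a' <M y else True).
  case: a Ha => // a /avoids1 /(_ xy) H; split=> [ax|]; first exact: ltM_trans xy.
  by case: H => // ya /(ltM_asym ya).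
have Eb : (if b is Some b' then x <M b' else True) <->
          (if b is Some b' then y <M b' else True).
  case: b Hb => // b /avoids1 /(_ xy) H; split=> [|yb]; last exact: ltM_trans yb.
  by case: H => // bx /(ltM_asym bx).
by rewrite Ea Eb.
Qed.

Lemma o_minimal_const_off (phi : pformula N) :
  o_minimal lt N -> exists s, const_off s (solutions phi).
Proof.
move=> [_ /(_ phi)[F [/finite_seqP[fs ->] Fpi ->]]].
have [s Hs] : exists s, forall X, X \in fs -> const_off s X.
  elim: fs Fpi => [|X fs IH] Fpi; first by exists [::].
  have [|s Hs] := IH; first by move=> Y Yfs; apply: Fpi; rewrite /= inE Yfs orbT.
  have [|s' Hs'] := @point_or_interval_const_off X.
    by apply: Fpi; rewrite /= inE eqxx.
  exists (s' ++ s) => Y; rewrite inE => /orP[/eqP->|Yfs] x y xy /avoids_cat[h h'].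
    exact: Hs'.
  exact: Hs.
by exists s => x y xy av; split=> -[X Xf Xx]; exists X => //;
  apply/(Hs X Xf x y xy av).
Qed.

Lemma const_off_inside s X v w : const_off s X ->
  (forall z, v <M z -> z <M w -> ~~ has (fun t => `[< t = z >]) s) ->
  forall x y, v <M x -> x <M w -> v <M y -> y <M w -> (X x <-> X y).
Proof.
move=> cs H x y vx xw vy yw.
have K a b : v <M a -> b <M w -> a <M b -> (X a <-> X b).
  move=> va bw ab; apply: cs => //; rewrite /avoids; apply/negP.
  elim: s H => //= t s IH H /orP[/asboolP[ta bt]|]; last first.
    by apply: IH => z vz zw; have := H z vz zw; rewrite negb_or => /andP[].
  have := H t (ltM_le_trans va ta) (leM_lt_trans bt bw).
  by rewrite negb_or => /andP[/asboolPn].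
have [->//|/ltM_total[xy|yx]] := pselect (x = y); first exact: K.
by have [] := K y x vy xw yx.
Qed.

(* [b] is the end, on the left resp. right, of the maximal interval around [u]
   on which [X] is constant, and it is not in this interval. *)
Definition left_end X b u :=
  b <M u /\ ~ (X b <-> X u) /\ forall x, b <M x -> x <M u -> (X x <-> X u).
Definition right_end X b u :=
  u <M b /\ ~ (X b <-> X u) /\ forall x, u <M x -> x <M b -> (X x <-> X u).

(** A first-order trace of o-minimality. The list [s] of [const_off] cannot be quantified over in
    the language, whereas for a definable [X] this property is a formula in its parameters. *)
Definition has_boundary X := forall e1 e2, e1 <M e2 -> ~ (X e1 <-> X e2) ->
  exists b v w, (~ b <M e1 /\ ~ e2 <M b) /\ (~ v <M e1 /\ ~ e2 <M w) /\ v <M w /\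
    ((forall u, v <M u -> u <M w -> left_end X b u) \/
     (forall u, v <M u -> u <M w -> right_end X b u)).

Lemma iffN_trans (A B C : Prop) : ~ (A <-> C) -> ~ (A <-> B) \/ ~ (B <-> C).
Proof. by move=> H; apply/not_andP => -[AB BC]; apply: H; rewrite AB. Qed.

(** Induction on the number of points of [s] strictly between [e1] and [e2]. If there is such a
    point [f], then [X] differs between [e1] and [f] or between [f] and [e2], and [f] is no longer
    inside the smaller interval. If there is none, [X] is constant on the open interval and differs
    there from its value at [e1] or at [e2]; that endpoint is [b]. *)
Lemma has_boundary_const_off s X : const_off s X -> has_boundary X.
Proof.
move=> cs e1 e2.
pose inside e1 e2 := fun z => `[< e1 <M z /\ z <M e2 >].
have [k] := ubnP (count (inside e1 e2) s).
elim: k e1 e2 => // k IH e1 e2 cnt e12 Xe.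
have [[f fs ef]|noF] :=
    pselect (exists2 f, has (fun t => `[< t = f >]) s & e1 <M f /\ f <M e2).
  have [e1f fe2] := ef.
  have [Xf|Xf] := iffN_trans (X f) Xe.
    have [|||b [v [w [[h1 h2] [[h3 h4] h]]]]] // := IH e1 f.
      apply: (@leq_trans (count (inside e1 e2) s)) => //.
      apply: (count_ltn _ fs); [|exact/asboolP|by apply/asboolP => -[_ /ltM_irr]].
      move=> z /asboolP[h h']; apply/asboolP; split=> //.
      by apply: ltM_trans fe2.
    exists b, v, w; split; [split=> //|split=> //; split=> //].
      by move=> /(ltM_trans fe2).
    by move=> /(ltM_trans fe2).
  have [|||b [v [w [[h1 h2] [[h3 h4] h]]]]] // := IH f e2.
    apply: (@leq_trans (count (inside e1 e2) s)) => //.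
    apply: (count_ltn _ fs); [|exact/asboolP|by apply/asboolP => -[/ltM_irr]].
    by move=> z /asboolP[h h']; apply/asboolP; split=> //; apply: ltM_trans h.
  exists b, v, w; split; [split=> //|split=> //; split=> //].
    by move=> be; apply: h1; apply: ltM_trans e1f.
  by move=> be; apply: h3; apply: ltM_trans e1f.
have cX : forall x y, e1 <M x -> x <M e2 -> e1 <M y -> y <M e2 -> (X x <-> X y).
  apply: const_off_inside cs _ => z h h'; apply/negP => Hz; apply: noF.
  by exists z.
have [m [e1m me2]] := ltM_dense e12.
have I := @ltM_irr; have A := ltM_asym e12.
have [Xm|Xm] := iffN_trans (X m) Xe; [exists e1|exists e2]; exists e1, e2; (do 3 split=> //).
  left=> u h h'; split=> //; split; first by rewrite (cX u m).
  by move=> x h1 h2; apply: cX => //; apply: ltM_trans h'.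
right=> u h h'; split=> //; split; first by rewrite (cX u m) // => -[? ?]; apply: Xm.
by move=> x h1 h2; apply: cX => //; apply: ltM_trans h1.
Qed.

Definition has_interval X :=
  exists v w, v <M w /\ forall u, v <M u -> u <M w -> X u.

(** At least [k] elements of [X] lie below the element [y] of [X]. Writing this as a descending
    chain makes it first-order for each fixed [k]. *)
Fixpoint rank_ge X k y : Prop :=
  if k is k'.+1 then X y /\ exists z, z <M y /\ rank_ge X k' z else X y.

(** If [x] and [y] in [X] satisfy [x <M y], some [t] of [s] lies in the closed interval between
    them, as otherwise [X] would contain the whole interval. Each point of [s] is counted once when
    it is at most [y] and once more when it is below [y]: the first count grows from [x] to [y] if
    [t] is above [x], the second if [t] is [x]. So the rank is at most twice the length of [s]. *)
Lemma rank_bounded s X : const_off s X -> ~ has_interval X ->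
  exists k, forall y, ~ rank_ge X k y.
Proof.
move=> cs noI.
pose cnt y := count (fun z => `[< ~ y <M z >]) s + count (fun z => `[< z <M y >]) s.
have cnt_lt x y : x <M y -> X x -> X y -> (cnt x < cnt y)%N.
  move=> xy Xx Xy.
  have : ~ avoids s x y.
    move=> av; apply: noI; exists x, y; split=> // u xu uy; apply/(cs x u) => //.
    apply: contraNN av; apply: sub_has => z /asboolP[zx uz]; apply/asboolP.
    by split=> // /(ltM_trans uy).
  move=> /negP/negPn/has_witness[t ts /asboolP[tx yt]].
  have le1 : subpred (fun z => `[< ~ x <M z >]) (fun z => `[< ~ y <M z >]).
    by move=> z /asboolP h; apply/asboolP => yz; apply: h; apply: ltM_trans yz.
  have le2 : subpred (fun z => `[< z <M x >]) (fun z => `[< z <M y >]).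
    by move=> z /asboolP h; apply/asboolP; apply: ltM_trans xy.
  have [xt|/nltM[//|e]] := pselect (x <M t).
    rewrite /cnt -addSn leq_add ?sub_count //.
    by apply: (count_ltn le1 ts); [exact/asboolP|apply/asboolP].
  rewrite /cnt -addnS leq_add ?sub_count //.
  by apply: (count_ltn le2 ts); rewrite e; apply/asboolP => //; apply: ltM_irr.
have rk k y : rank_ge X k y -> (k <= cnt y)%N.
  elim: k y => // k IH y [Xy [z [zy rz]]]; apply: leq_ltn_trans (IH _ rz) _.
  by apply: cnt_lt => //; case: (k) rz => // k' [].
exists (size s + size s).+1 => y /rk.
by rewrite ltnNge; apply/negP/negPn; rewrite leq_add ?count_size.
Qed.

End Order.

(** * Sets definable over parameters, and saturation *)

Definition defset L (M : structure L) (A : set M) (X : set M) :=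
  exists phi : pformula M, over A phi /\ solutions phi = X.

Definition join T n m (v : 'I_n -> T) (w : 'I_m -> T) (i : 'I_(n + m)) : T :=
  match fintype.split i with inl j => v j | inr j => w j end.

Lemma join_lshift T n m (v : 'I_n -> T) (w : 'I_m -> T) j :
  join v w (lshift m j) = v j.
Proof. by rewrite /join; case: split_ordP => k /eqP; rewrite eq_shift // => /eqP->. Qed.

Lemma join_rshift T n m (v : 'I_n -> T) (w : 'I_m -> T) j :
  join v w (rshift n j) = w j.
Proof. by rewrite /join; case: split_ordP => k /eqP; rewrite eq_shift // => /eqP->. Qed.

Section Definable_sets.
Context (L : language) (M : structure L).
Implicit Types (A B X Y : set M).

Lemma defset_def A n (R : forall N : structure L, ('I_n.+1 -> N) -> Prop)
    (b : 'I_n -> M) :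
  definable R -> (forall i, A (b i)) -> defset A [set x | R M (scons x b)].
Proof.
move=> [phi Hphi] bA; exists (@PFormula L M n phi b); split=> //.
by apply/seteqP; split=> x; rewrite /solutions /= Hphi.
Qed.

Lemma defsetS A B X : A `<=` B -> defset A X -> defset B X.
Proof. by move=> AB [phi [oA <-]]; exists phi; split=> // i; apply: AB. Qed.

Lemma defsetI A X Y : defset A X -> defset A Y -> defset A (X `&` Y).
Proof.
move=> [[n f p] [/= op <-]] [[m g q] [/= oq <-]].
pose R := fun (N : structure L) (w : 'I_(n + m).+1 -> N) =>
  @sat L N _ f (scons (w ord0) (fun i => w (lift ord0 (lshift m i)))) /\
  @sat L N _ g (scons (w ord0) (fun i => w (lift ord0 (rshift n i)))).
have -> : solutions (PFormula f p) `&` solutions (PFormula g q) =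
    [set x | R M (scons x (join p q))].
  apply/funext => x; rewrite /R /solutions /= scons0.
  have -> : (fun i => scons x (join p q) (lift ord0 (lshift m i))) = p.
    by apply/funext => i; rewrite sconsS join_lshift.
  have -> // : (fun i => scons x (join p q) (lift ord0 (rshift n i))) = q.
  by apply/funext => i; rewrite sconsS join_rshift.
apply: defset_def; first by rewrite /R; definability.
by move=> i; rewrite /join; case: fintype.split => j; [exact: (op j)|exact: (oq j)].
Qed.

Lemma defsetC A X : defset A X -> defset A (~` X).
Proof. by move=> [phi [oA <-]]; exists (pnot phi); split. Qed.

Lemma defset_ltr A lt a : A a -> defset A [set x | ltM lt x a].
Proof.
move=> Aa.
have := @defset_def A 1 (fun (N : structure L) w =>
  ltM lt (w ord0) (w (lift ord0 ord0))) (fun _ => a).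
by move=> -[||phi [? E]]; [definability|by []|]; exists phi; split=> //; rewrite E;
  apply/seteqP; split=> x; rewrite /= scons0 sconsS.
Qed.

Lemma defset_ltl A lt a : A a -> defset A [set x | ltM lt a x].
Proof.
move=> Aa.
have := @defset_def A 1 (fun (N : structure L) w =>
  ltM lt (w (lift ord0 ord0)) (w ord0)) (fun _ => a).
by move=> -[||phi [? E]]; [definability|by []|]; exists phi; split=> //; rewrite E;
  apply/seteqP; split=> x; rewrite /= scons0 sconsS.
Qed.

Lemma defset1 A a : A a -> defset A [set a].
Proof.
move=> Aa.
have := @defset_def A 1 (fun (N : structure L) w => w ord0 = w (lift ord0 ord0)) (fun _ => a).
by move=> -[||phi [? E]]; [definability|by []|]; exists phi; split=> //; rewrite E;
  apply/seteqP; split=> x; rewrite /= scons0 sconsS.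
Qed.

Lemma defsetT A : defset A setT.
Proof.
exists (@PFormula L M 0 (FNot (FBot L 1)) (@env0 M)); split; first by case.
by apply/seteqP; split=> // x _ [].
Qed.

(** The point [p] need not be in [A]; it is replaced by the unique solution of its defining
    formula. *)
Lemma defset_lt_dcl A lt p : dcl A p ->
  defset A [set x | ltM lt x p] /\ defset A [set x | ltM lt p x].
Proof.
move=> [[n f q] [/= oq E]].
have Ep y : sat f (scons y q) <-> y = p by have := congr1 (@^~ y) E => /= <-.
split.
- have := @defset_def A n (fun (N : structure L) w => exists y,
    sat f (scons y (fun i => w (lift ord0 i))) /\ ltM lt (w ord0) y) q.
  move=> -[||phi [ophi Ephi]] //; first by definability.
  exists phi; split=> //; rewrite Ephi; apply/funext => x /=; apply/propext.
  rewrite scons0 scons_tail.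
  by split=> [[y [/Ep ->]]|xp] //; exists p; split=> //; apply/Ep.
- have := @defset_def A n (fun (N : structure L) w => exists y,
    sat f (scons y (fun i => w (lift ord0 i))) /\ ltM lt y (w ord0)) q.
  move=> -[||phi [ophi Ephi]] //; first by definability.
  exists phi; split=> //; rewrite Ephi; apply/funext => x /=; apply/propext.
  rewrite scons0 scons_tail.
  by split=> [[y [/Ep ->]]|xp] //; exists p; split=> //; apply/Ep.
Qed.

Lemma ultra_type_over A (U : set_system M) : UltraFilter U ->
  type_over A [set phi | over A phi /\ U (solutions phi)].
Proof.
move=> UU; have PU : ProperFilter U by apply: ultra_proper.
split=> [phi []//|q|phi oA]; last first.
  by have [h|h] := in_ultra_setVsetC (solutions phi) UU; [left|right].
move=> /(@finite_seqP {classic pformula M})[s ->] sub.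
have : U [set a | forall phi, phi \in s -> solutions phi a].
  elim: s sub => [|phi s IH] sub; first by by apply: (@filterS _ U _ setT) filterT => a _.
  have [] : over A phi /\ U (solutions phi) by apply: sub; rewrite /= inE eqxx.
  move=> _ Uphi; apply: (filterS _ (filterI Uphi (IH _))).
    move=> a [phia sa] psi; rewrite inE => /orP[/eqP->//|]; exact: sa.
  by move=> psi psis; apply: sub; rewrite /= inE psis orbT.
by move=> /filter_ex[a Ha]; exists a.
Qed.

(** The filter extends to an ultrafilter, whose [A]-definable members form a complete type over [A].
    With this form, consistency of a partial type is just properness of a filter. *)
Lemma saturation A (F : set_system M) :
  saturated M -> card_lt A [set: M] -> ProperFilter F ->
  exists a, forall X, defset A X -> F X -> X a.
Proof.
move=> satM smallA /ultraFilterLemma[U [UU FU]].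
have [a ra] := satM A smallA _ (ultra_type_over A UU).
by exists a => X [phi [oA <-]] FX; apply: ra; split=> //; apply: FU.
Qed.

(** [th] acts as a partial 0-definable unary function with value [y] at [u]. It keeps [n] parameter
    variables, all filled with [u], because this is what a definition over the singleton of [u]
    looks like. *)
Definition isval n (th : formula L n.+1) (N : structure L) (u y : N) :=
  forall z, sat th (scons z (fun _ : 'I_n => u)) <-> z = y.

Lemma dcl1P (u y : M) :
  dcl [set u] y <-> exists n (th : formula L n.+1), isval th u y.
Proof.
split=> [[[n th p] [/= op E]]|[n [th H]]].
  exists n, th => z.
  have -> : (fun _ => u) = p by apply/funext => i; apply/esym/(op i).
  by have := congr1 (@^~ z) E; rewrite /solutions /= => ->.
exists (PFormula th (fun _ => u)); split=> //.
by apply/seteqP; split=> z; rewrite /solutions /= H.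
Qed.

Lemma dclS A B : A `<=` B -> dcl A `<=` dcl B.
Proof. by move=> AB y; apply: defsetS. Qed.

End Definable_sets.

Lemma def_isval L m n (th : formula L n.+1) (i j : 'I_m) :
  definable (fun (N : structure L) w => @isval L n th N (w i) (w j)).
Proof. by rewrite /isval; definability. Qed.

Lemma def_rank_ge L lt (R : forall N : structure L, N -> Prop) k :
  definable (fun N (w : 'I_1 -> N) => R N (w ord0)) ->
  definable (fun N (w : 'I_1 -> N) => rank_ge lt (R N) k (w ord0)).
Proof.
move=> HR; elim: k => // k IH /=; apply: def_and => //.
by apply/def_ex/def_and; [exact: def_lt|exact: (def_subst (fun _ => ord0) IH)].
Qed.

(** * Elementary partial maps and their one-point extensions *)

(** A relation replaces a partial map: applied to equations, the condition already makes it
    functional and injective, and inverting it is a mere swap of coordinates. *)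
Definition elementary_rel L (M : structure L) (G : set (M * M)) :=
  forall n (phi : formula L n) (v : 'I_n -> M * M), (forall i, G (v i)) ->
    (sat phi (fun i => (v i).1) <-> sat phi (fun i => (v i).2)).

Section Elementary_relations.
Context (L : language) (M : structure L).
Implicit Types (G : set (M * M)) (c d : M).

Lemma elementary_rel_def G n
    (R : forall N : structure L, ('I_n -> N) -> Prop) (v : 'I_n -> M * M) :
  elementary_rel G -> definable R -> (forall i, G (v i)) ->
  (R M (fun i => (v i).1) <-> R M (fun i => (v i).2)).
Proof. by move=> eG [phi Hphi] Gv; rewrite -!Hphi; apply: eG. Qed.

Definition same_type G c d :=
  forall n (phi : formula L n.+1) (v : 'I_n -> M * M), (forall i, G (v i)) ->
    (sat phi (scons c (fun i => (v i).1)) <-> sat phi (scons d (fun i => (v i).2))).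

(** The pair [(c, d)] may occur in the tuple at several places. The indices whose pair is in [G] are
    enumerated by [S], the renaming [r] sends all others to variable [ord0], and [same_type] is
    applied to the renamed formula. *)
Lemma elementary_relU1 G c d : same_type G c d -> elementary_rel ((c, d) |` G).
Proof.
move=> eGc n phi v Gv.
pose S := [set i | `[< G (v i) >]]%SET.
pose w (j : 'I_#|S|) := v (enum_val j).
pose r i : 'I_#|S|.+1 :=
  if [pick j : 'I_#|S| | enum_val j == i] is Some j then lift ord0 j else ord0.
have Gw j : G (w j).
  by have := enum_valP j; rewrite /S finset.in_set => /asboolP.
have := eGc _ (frename phi r) w Gw; rewrite !sat_frename.
have rP i : (exists2 j, r i = lift ord0 j & w j = v i) \/ (r i = ord0 /\ v i = (c, d)).
  rewrite /r; case: pickP => [j /eqP ji|nj]; first by left; exists j; rewrite /w ?ji.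
  right; split=> //; case: (Gv i) => // Gi.
  have iS : i \in S by rewrite /S finset.in_set; apply/asboolP.
  by have := nj (enum_rank_in iS i); rewrite enum_rankK_in ?eqxx.
have -> : (fun i => scons c (fun j => (w j).1) (r i)) = (fun i => (v i).1).
  by apply/funext => i; have [[j -> <-]|[-> ->]] := rP i; rewrite ?sconsS ?scons0.
have -> // : (fun i => scons d (fun j => (w j).2) (r i)) = (fun i => (v i).2).
by apply/funext => i; have [[j -> <-]|[-> ->]] := rP i; rewrite ?sconsS ?scons0.
Qed.

Lemma over_fst G (phi : pformula M) : over (fst @` G) phi ->
  exists q : 'I_(arity_par phi) -> M * M,
    (forall i, G (q i)) /\ par phi = (fun i => (q i).1).
Proof.
move=> ophi; have /choice[q Hq] i : exists p, G p /\ p.1 = par phi i.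
  by have [p Gp e] := ophi i; exists p.
by exists q; split=> [i|]; [case: (Hq i)|apply/funext => i; case: (Hq i)].
Qed.

Lemma over_snd G (phi : pformula M) : over (snd @` G) phi ->
  exists q : 'I_(arity_par phi) -> M * M,
    (forall i, G (q i)) /\ par phi = (fun i => (q i).2).
Proof.
move=> ophi; have /choice[q Hq] i : exists p, G p /\ p.2 = par phi i.
  by have [p Gp e] := ophi i; exists p.
by exists q; split=> [i|]; [case: (Hq i)|apply/funext => i; case: (Hq i)].
Qed.

Lemma join_comp T U n m (h : T -> U) (v : 'I_n -> T) (w : 'I_m -> T) :
  (fun j => h (join v w (lshift m j))) = (fun j => h (v j)) /\
  (fun j => h (join v w (rshift n j))) = (fun j => h (w j)).
Proof. by split; apply/funext => j; rewrite ?join_lshift ?join_rshift. Qed.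

Lemma joinP T n m (A : set T) (v : 'I_n -> T) (w : 'I_m -> T) :
  (forall i, A (v i)) -> (forall i, A (w i)) -> forall i, A (join v w i).
Proof. by move=> Av Aw i; rewrite /join; case: fintype.split. Qed.

(** The formula defining [c] still has a unique solution [d] after its parameters are moved along
    [G]. A property of [c] is then a property of the parameters alone: some solution of the defining
    formula has it. *)
Lemma dcl_transfer G c : elementary_rel G -> dcl (fst @` G) c ->
  exists d, same_type G c d.
Proof.
move=> eG [[n f p] [/over_fst[q [/= Gq ->]] E]].
have Ec z : sat f (scons z (fun i => (q i).1)) <-> z = c.
  by have := congr1 (@^~ z) E => /= <-.
have defR : definable (fun (N : structure L) (w : 'I_n -> N) =>
    exists y, forall z, sat f (scons z (fun i => w i)) <-> z = y).
  by definability.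
have [+ _] := elementary_rel_def eG defR Gq => -[|d Hd]; first by exists c.
exists d => m phi v Gv.
have {}defR : definable (fun (N : structure L) (w : 'I_(n + m) -> N) => exists y,
    sat f (scons y (fun i => w (lshift m i))) /\
    sat phi (scons y (fun i => w (rshift n i)))).
  by definability.
have := elementary_rel_def eG defR (joinP Gq Gv).
have [-> ->] := join_comp fst q v; have [-> ->] := join_comp snd q v.
move=> [H1 H2]; split=> H.
- have [|y [/Hd ->]] // := H1.
  by exists c; split=> //; apply/Ec.
- have [|y [/Ec ->]] // := H2.
  by exists d; split=> //; apply/Hd.
Qed.

Lemma same_type_def G c d n
    (R : forall N : structure L, ('I_n.+1 -> N) -> Prop) (v : 'I_n -> M * M) :
  same_type G c d -> definable R -> (forall i, G (v i)) ->
  (R M (scons c (fun i => (v i).1)) <-> R M (scons d (fun i => (v i).2))).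
Proof. by move=> eG [phi Hphi] Gv; rewrite -!Hphi; apply: eG. Qed.

(** The formulas true of [c], with parameters moved along [G], define sets closed under
    intersection. These sets are non-empty because [G] preserves existential statements, so a common
    point exists by saturation. *)
Lemma type_transfer G c : saturated M -> elementary_rel G ->
  card_lt (snd @` G) [set: M] -> exists d, same_type G c d.
Proof.
move=> satM eG smallG.
pose I := [set X : set M | exists n (phi : formula L n.+1) (v : 'I_n -> M * M),
  [/\ forall i, G (v i), sat phi (scons c (fun i => (v i).1))
     & X = [set x | sat phi (scons x (fun i => (v i).2))]]].
have PF : ProperFilter (filter_from I id).
  apply: filter_from_proper; last first.
    move=> X [n [phi [v [Gv cv ->]]]].
    have defR : definable (fun (N : structure L) (w : 'I_n -> N) =>
      exists y, sat phi (scons y (fun i => w i))) by definability.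
    have [+ _] := elementary_rel_def eG defR Gv => -[|d Hd]; first by exists c.
    by exists d.
  apply: filter_from_filter.
    exists setT, 0, (FNot (FBot L 1)), (fun _ => (c, c)); split=> //; first by case.
    by apply/seteqP; split=> // x _ [].
  move=> X Y [n [phi [v [Gv cv ->]]]] [m [psi [w [Gw cw ->]]]].
  pose R (N : structure L) (z : 'I_(n + m).+1 -> N) :=
    sat phi (scons (z ord0) (fun i => z (lift ord0 (lshift m i)))) /\
    sat psi (scons (z ord0) (fun i => z (lift ord0 (rshift n i)))).
  have [chi Hchi] : definable R by rewrite /R; definability.
  have E (x : M) (h : M * M -> M) : sat chi (scons x (fun i => h (join v w i))) <->
      sat phi (scons x (fun i => h (v i))) /\ sat psi (scons x (fun i => h (w i))).
    rewrite Hchi /R scons0.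
    have [<- <-] := join_comp h v w.
    have S k (t : 'I_k -> 'I_(n + m)) : (fun i => scons x (fun i => h (join v w i))
        (lift ord0 (t i))) = (fun i => h (join v w (t i))).
      by apply/funext => i; rewrite sconsS.
    by rewrite !S.
  exists [set x | sat chi (scons x (fun i => (join v w i).2))].
    by exists (n + m), chi, (join v w); split=> //; [exact: joinP|apply/(E _ fst)].
  by move=> x /(E _ snd).
have [d Hd] := saturation satM smallG PF.
have imp n (phi : formula L n.+1) (v : 'I_n -> M * M) : (forall i, G (v i)) ->
    sat phi (scons c (fun i => (v i).1)) -> sat phi (scons d (fun i => (v i).2)).
  move=> Gv cv; apply: (Hd [set x | sat phi (scons x (fun i => (v i).2))]).
    by exists (PFormula phi (fun i => (v i).2)); split=> // i; exists (v i).
  by eexists; [exists n, phi, v; split; [| |reflexivity]|].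
exists d => n phi v Gv; split; first exact: imp.
by move=> dv; apply: contrapT => ncv; have := imp _ (FNot phi) v Gv ncv; apply.
Qed.

Lemma same_type_ndcl G c d : same_type G c d -> dcl (snd @` G) d -> dcl (fst @` G) c.
Proof.
move=> cd [[n f p] [/over_snd[q [/= Gq ->]] E]].
have Ed z : sat f (scons z (fun i => (q i).2)) <-> z = d.
  by have := congr1 (@^~ z) E => /= <-.
have defR : definable (fun (N : structure L) (w : 'I_n.+1 -> N) =>
    forall z, sat f (scons z (fun i => w (lift ord0 i))) <-> z = w ord0).
  by definability.
have := same_type_def cd defR Gq.
rewrite !scons0 !scons_tail => -[_ /(_ Ed) Ec].
exists (PFormula f (fun i => (q i).1)); split; first by move=> i; exists (q i).
by apply/seteqP; split=> z; rewrite /solutions /= Ec.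
Qed.

Definition swap_rel G : set (M * M) := [set p | G (p.2, p.1)].

Lemma swap_same_type G c d : same_type G c d -> same_type (swap_rel G) d c.
Proof.
by move=> cd n phi v Gv; have [] := cd n phi (fun i => ((v i).2, (v i).1)) Gv.
Qed.

Lemma swap_elementary G : elementary_rel G -> elementary_rel (swap_rel G).
Proof.
by move=> eG n phi v Gv; have [] := eG n phi (fun i => ((v i).2, (v i).1)) Gv.
Qed.

Definition partial_iso (P D : set M) (G : set (M * M)) :=
  elementary_rel G /\ forall p, G p -> (P p.1 <-> D p.2).

Lemma swap_partial_iso D D' G :
  partial_iso D D' G -> partial_iso D' D (swap_rel G).
Proof.
move=> [eG HG]; split; first exact: swap_elementary.
by move=> [x y] /HG /= [? ?].
Qed.

Lemma elementary_isval G n (th : formula L n.+1) (a b c d : M) :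
  elementary_rel G -> G (a, b) -> G (c, d) -> isval th a c -> isval th b d.
Proof.
move=> eG Gab Gcd.
have := elementary_rel_def eG (def_isval th (ord0 : 'I_2) (lift ord0 ord0))
  (v := scons (a, b) (fun _ => (c, d))).
rewrite sconsS scons0 /= => -[|H _]; last exact: H.
by move=> i; rewrite /scons; case: unlift.
Qed.

Lemma elementary_dcl0 G (c d : M) : elementary_rel G -> G (c, d) ->
  dcl (set0 : set M) c -> dcl (set0 : set M) d.
Proof.
move=> eG Gcd [[n f p] [/= op E]].
(* Over the empty set there are no parameters, so [f] may be read as a unary function with constant
   value [c]. *)
have Ef x : (fun _ : 'I_n => x) = p by apply/funext => i; case: (op i).
have Hc : isval f c c.
  by move=> z; rewrite Ef; have := congr1 (@^~ z) E => /= <-.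
have Hd := elementary_isval eG Gcd Gcd Hc.
exists (PFormula f p); split=> //.
by apply/seteqP; split=> z; rewrite /solutions /= -(Ef d) Hd.
Qed.

End Elementary_relations.

(** * Types in a saturated structure with trivial dcl *)

Section Trivial_geometry.
Context (L : language) (lt : rsym L 2) (M : structure L).
Local Notation "x <M y" := (ltM lt x y) (at level 70).
Local Notation small A := (card_lt A [set: M]).
Hypothesis dlo : dense_linear_order lt M.
(** O-minimality enters this section only through [boundary] and [ranked]. *)
Hypothesis boundary : forall phi : pformula M, has_boundary lt (solutions phi).
Hypothesis ranked : forall R : forall N : structure L, N -> Prop,
  definable (fun N (w : 'I_1 -> N) => R N (w ord0)) ->
  ~ has_interval lt (R M) -> exists k, forall y, ~ rank_ge lt (R M) k y.
Hypothesis trivial : forall A : set M, A !=set0 -> dcl A = \bigcup_(a in A) dcl [set a].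
Hypothesis satM : saturated M.
Hypothesis smallU : forall A B : set M, small A -> small B -> small (A `|` B).
Hypothesis small1 : forall a : M, small [set a].

(** Each clause is first-order in the language with the predicate, the last one being a scheme in
    [th]; hence these properties pass from lovely pairs to every member of the elementary class. *)
Definition dense_pred (D : set M) :=
  [/\ forall x y, x <M y -> exists z, [/\ x <M z, z <M y & D z],
      forall x y, x <M y -> exists z, [/\ x <M z, z <M y & ~ D z]
    & forall n (th : formula L n.+1) u y, D u -> isval th u y -> D y].

Variable P : set M.
Hypothesis denseP : dense_pred P.

(* If the set of values taken on an interval contained an interval, it would
   contain a point outside [P], taken as a value at some point of [P]. *)
Lemma constant_value n (th : formula L n.+1) (v w y : M) :
  v <M w -> (forall u, v <M u -> u <M w -> isval th u y) -> dcl (set0 : set M) y.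
Proof.
move=> vw H; have [dP cdP clP] := denseP.
pose R (N : structure L) (y : N) := has_interval lt (fun u => isval th u y).
have defR : definable (fun N (w : 'I_1 -> N) => R N (w ord0)).
  rewrite /R /has_interval; apply/def_ex/def_ex/def_and; first exact: def_lt.
  by apply/def_all/def_imp; [exact: def_lt|apply/def_imp; [exact: def_lt|exact: def_isval]].
have noI : ~ has_interval lt (R M).
  move=> [p [q [/cdP[y' [py yq Py]] HR]]].
  have [v' [w' [/dP[u [vu uw Pu]] HU]]] := HR _ py yq.
  by apply: Py; apply: clP Pu (HU _ vu uw).
have [k0 Hk0] := ranked defR noI.
(* With the least such number written [k.+1], the point [y] has rank exactly [k] in [R M]. It is the
   only such point: of two comparable points of rank at least [k], the upper one has rank at least
   [k.+1]. This defines [y] without parameters. *)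
have ex : exists k, `[< ~ rank_ge lt (R M) k y >] by exists k0; apply/asboolP.
have [k /asboolP nk mink] := ex_minnP ex.
case: k nk mink => [|k] nk mink; first by case: nk; exists v, w.
have rk : rank_ge lt (R M) k y.
  apply: contrapT => h; suff : (k.+1 <= k)%N by rewrite ltnn.
  exact/mink/asboolP.
have rkR k' z : rank_ge lt (R M) k' z -> R M z by case: k' => // k' [].
have [phi Hphi] := def_and (def_rank_ge lt k defR)
  (def_not (def_rank_ge lt k.+1 defR)).
exists (@PFormula L M 0 phi (@env0 M)); split; first by case.
apply/seteqP; split=> z; rewrite /solutions /= Hphi scons0; last by move->.
move=> [rz nrz]; apply: contrapT => /(ltM_total dlo)[zy|yz].
  by apply: nk; split; [exact: rkR rk|exists z].
by apply: nrz; split; [exact: rkR rz|exists y].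
Qed.

(** If membership changes inside the interval, [boundary] yields a subinterval all of whose points
    differ in membership from one point [b], hence agree with each other. *)
Lemma constant_on_subinterval (phi : pformula M) (v w : M) : v <M w ->
  exists v' w', (~ v' <M v /\ ~ w <M w') /\ v' <M w' /\
    forall x y, v' <M x -> x <M w' -> v' <M y -> y <M w' ->
      (solutions phi x <-> solutions phi y).
Proof.
move=> vw; have irr := ltM_irr dlo.
have [H|/existsNP[x /existsNP[y /not_implyP[[vx xw] /not_implyP[[vy yw] H]]]]] :=
  pselect (forall x y, v <M x /\ x <M w -> v <M y /\ y <M w ->
      (solutions phi x <-> solutions phi y)).
  by exists v, w; do 2 split=> //; move=> x y *; apply: H.
wlog xy : x y vx xw vy yw H / x <M y => [W|].
  have [e|/(ltM_total dlo)[xy|yx]] := pselect (x = y); first by case: H; rewrite e.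
    exact: (W x y).
  by apply: (W y x) => // -[? ?]; apply: H.
have [b [v' [w' [_ [[h1 h2] [vw' h]]]]]] := boundary xy H.
exists v', w'; split; [split|split=> //].
- by move=> /(ltM_trans dlo)/(_ vx).
- by move=> /(ltM_trans dlo yw).
have C z : v' <M z -> z <M w' -> ~ (solutions phi b <-> solutions phi z).
  by move=> vz zw; case: h => /(_ _ vz zw)[_ []].
move=> z t vz zw vt tw; have := C z vz zw; have := C t vt tw.
by have [] := pselect (solutions phi b); have [] := pselect (solutions phi z);
   have [] := pselect (solutions phi t); tauto.
Qed.

(** A compactness argument. If no single [th] worked on a subinterval, then any finite list of
    formulas would fail at once somewhere between [v] and [w]. Saturation over [v], [w] and [b]
    would give one [u] where every formula fails, although [b] is in the closure of [u]. *)
Lemma uniform_value (b v w : M) : v <M w ->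
  (forall u, v <M u -> u <M w -> dcl [set u] b) ->
  exists n (th : formula L n.+1) (v' w' : M), v' <M w' /\
    forall u, v' <M u -> u <M w' -> isval th u b.
Proof.
move=> vw H; apply: contrapT => noth.
pose bad (s : seq {n & formula L n.+1}) (u : M) :=
  all (fun th => `[< ~ isval (projT2 th) u b >]) s.
pose W s := [set u | (v <M u /\ u <M w) /\ bad s u].
pose A := [set v] `|` [set w] `|` [set b].
have defA n (th : formula L n.+1) : defset A [set u : M | isval th u b].
  have [phi Hphi] := def_isval th (ord0 : 'I_2) (lift ord0 ord0).
  exists (@PFormula L M 1 phi (fun _ => b)); split=> [i|]; first by right.
  by apply/seteqP; split=> u; rewrite /solutions /= Hphi scons0 sconsS.
(* The interval is shrunk once for each formula of [s]: on a suitable subinterval the formula has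
   value [b] everywhere or nowhere, and the first case is excluded by [noth]. *)
have W0 s : exists v' w', (~ v' <M v /\ ~ w <M w') /\ v' <M w' /\
    forall u, v' <M u -> u <M w' -> bad s u.
  elim: s => [|[n th] s [v' [w' [[h1 h2] [vw' Hs]]]]].
    by exists v, w; do 2 split=> //; apply: ltM_irr.
  have [phi [_ Ephi]] := defA n th.
  have [v1 [w1 [[h3 h4] [vw1 cst]]]] := constant_on_subinterval phi vw'.
  exists v1, w1; split; [split|split=> //].
  - exact: (leM_trans dlo) h3.
  - exact: (leM_trans dlo) h4 h2.
  move=> u vu uw; apply/andP; split; last first.
    by apply: Hs; [exact: (leM_lt_trans dlo) vu|exact: (ltM_le_trans dlo) uw h4].
  apply/asboolP => /= ub; apply: noth; exists n, th, v1, w1; split=> // z vz zw.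
  have : solutions phi z by apply/(cst z u) => //; rewrite Ephi.
  by rewrite Ephi.
have PF : ProperFilter (filter_from [set: seq {n & formula L n.+1}] W).
  apply: filter_from_proper; last first.
    move=> s _; have [v' [w' [[h1 h2] [/(ltM_dense dlo)[u [vu uw] Hs]]]]] := W0 s.
    exists u; split; last exact: Hs.
    by split; [exact: (leM_lt_trans dlo) vu|exact: (ltM_le_trans dlo) uw h2].
  apply: filter_fromT_filter; first by exists [::].
  move=> s t; exists (s ++ t) => u [uvw]; rewrite /bad all_cat => /andP[? ?].
  by split.
have [|u Hu] := @saturation L M A _ satM _ PF; first by apply: smallU => //; apply: smallU.
have [uv uw] : v <M u /\ u <M w.
  split; [apply: (Hu [set u | v <M u])|apply: (Hu [set u | u <M w])].
  - by apply: defset_ltl; left; left.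
  - by exists [::] => // z [[]].
  - by apply: defset_ltr; left; right.
  - by exists [::] => // z [[]].
have /dcl1P[n [th Hth]] := H u uv uw.
suff : (~` [set u : M | isval th u b]) u by apply.
apply: Hu; first exact/defsetC/defA.
by exists [:: existT _ n th] => // z [_ /= /andP[/asboolP]].
Qed.

Lemma left_end_uniq X (b b' u : M) : left_end lt X b u -> left_end lt X b' u -> b = b'.
Proof.
move=> [bu [nb Hb]] [bu' [nb' Hb']]; apply: contrapT => /(ltM_total dlo)[h|h].
  exact/nb'/Hb.
exact/nb/Hb'.
Qed.

Lemma right_end_uniq X (b b' u : M) : right_end lt X b u -> right_end lt X b' u -> b = b'.
Proof.
move=> [bu [nb Hb]] [bu' [nb' Hb']]; apply: contrapT => /(ltM_total dlo)[h|h].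
  exact/nb/Hb'.
exact/nb'/Hb.
Qed.

(** Being the left, or right, end for [u] is expressible from [u] and the parameters of [X], and at
    most one point has this property. *)
Lemma end_dcl A X (b u : M) : defset A X ->
  left_end lt X b u \/ right_end lt X b u -> dcl (u |` A) b.
Proof.
move=> [[n f p] [/= op <-]].
have oA i : (u |` A) (scons u p i).
  by rewrite /scons; case: unliftP => [j _|_]; [right; exact: (op j)|left].
have E (Y : set M) : Y b -> (forall b', Y b' -> b' = b) -> Y = [set b].
  by move=> Yb H; apply/seteqP; split=> z; [apply: H|move->].
have tail2 b' : (fun i => scons b' (scons u p) (lift ord0 (lift ord0 i))) = p.
  by apply/funext => i; rewrite !sconsS.
case=> H.
- have := @defset_def L M (u |` A) n.+1 (fun (N : structure L) w =>
    left_end lt (fun x => sat f (scons x (fun i => w (lift ord0 (lift ord0 i)))))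
      (w ord0) (w (lift ord0 ord0))) (scons u p).
  move=> -[||phi [ophi Ephi]] //; first by rewrite /left_end; definability.
  exists phi; split=> //; rewrite Ephi; apply: E => /=.
    by rewrite scons0 sconsS scons0 tail2.
  move=> b' /=; rewrite scons0 sconsS scons0 tail2 => H'; exact: left_end_uniq H' H.
- have := @defset_def L M (u |` A) n.+1 (fun (N : structure L) w =>
    right_end lt (fun x => sat f (scons x (fun i => w (lift ord0 (lift ord0 i)))))
      (w ord0) (w (lift ord0 ord0))) (scons u p).
  move=> -[||phi [ophi Ephi]] //; first by rewrite /right_end; definability.
  exists phi; split=> //; rewrite Ephi; apply: E => /=.
    by rewrite scons0 sconsS scons0 tail2.
  move=> b' /=; rewrite scons0 sconsS scons0 tail2 => H'; exact: right_end_uniq H' H.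
Qed.

(* Triviality applied to a boundary point [b] and all nearby [u]: either [b] is
   in [dcl A] or [b] is a value, at every nearby [u], of a 0-definable unary
   function. *)
Lemma cut_dcl A X (e1 e2 : M) : defset A X -> e1 <M e2 -> ~ (X e1 <-> X e2) ->
  exists p, dcl A p /\ ~ p <M e1 /\ ~ e2 <M p.
Proof.
move=> DX e12 H.
have bX : has_boundary lt X by have [phi [_ <-]] := DX.
have [b [v [w [b12 [_ [vw ends]]]]]] := bX _ _ e12 H.
have ub u : v <M u -> u <M w -> dcl (u |` A) b.
  by move=> vu uw; apply: end_dcl DX _; case: ends => /(_ u vu uw); [left|right].
exists b; split=> //; apply: contrapT => nb.
have [u vu uw|n [th [v' [w' [vw' /(constant_value vw')]]]]] := @uniform_value b _ _ vw.
  have := ub u vu uw; rewrite trivial; last by exists u; left.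
  move=> [a [->//|Aa] /(dclS _)ba]; case: nb; apply: ba.
  by move=> _ ->.
by move=> /(dclS (@sub0set _ A)).
Qed.

(** Saturation gives a second realization [e] of the type of [c] over [A]. No point of [dcl A] lies
    between [c] and [e], since it would separate their types. By [cut_dcl] no [A]-definable set
    changes between [c] and a point before [e], so all points strictly between [c] and [e] have the
    type of [c]. *)
Lemma interval_type A (c : M) : small A -> ~ dcl A c ->
  exists p q, p <M q /\
    forall x, p <M x -> x <M q -> forall X, defset A X -> (X x <-> X c).
Proof.
move=> smallA nc.
(* Removing [c] from the sets forces the realization to differ from [c]; they stay non-empty because
   [c] is not in [dcl A]. *)
have PF : ProperFilter (filter_from [set X | defset A X /\ X c] (fun X => X `\ c)).
  apply: filter_from_proper; last first.
    move=> X [DX Xc]; apply: contrapT => noX; apply: nc.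
    suff E : X = [set c] by move: DX; rewrite E.
    apply/seteqP; split=> [x Xx|_ -> //]; apply: contrapT => xc; apply: noX.
    by exists x.
  apply: filter_from_filter.
    by exists setT; split=> //; exact: defsetT.
  move=> X Y [DX Xc] [DY Yc]; exists (X `&` Y).
    by split; [exact: defsetI|].
  by move=> x [[]].
have [|e He] := @saturation L M (c |` A) _ satM _ PF; first exact: smallU.
have Ae X : defset A X -> (X e <-> X c).
  move=> DX; split=> [Xe|Xc]; last first.
    apply: He; first by apply: defsetS DX => x Ax; right.
    by exists X => // x [].
  apply: contrapT => nXc; have : (~` X) e; last by [].
  apply: He; first by apply/defsetC; apply: defsetS DX => x Ax; right.
  by exists (~` X); [split=> //; exact: defsetC|move=> x []].
have ec : e <> c.
  apply: (He (~` [set c])); first by apply/defsetC/defset1; left.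
  by exists setT => [|x []//]; split=> //; exact: defsetT.
(* The half-open intervals exclude [c] but include [e]; the remaining case, where [p] is [c], is
   excluded by [nc]. *)
have nolt p : dcl A p -> ~ (c <M p /\ ~ e <M p) /\ ~ (p <M c /\ ~ p <M e).
  move=> dp; have [lp gp] := @defset_lt_dcl L M A lt p dp.
  have [El Eg] := (Ae _ lp, Ae _ gp).
  have pc : p <> c by move=> pe; apply: nc; rewrite -pe.
  split=> -[cp /(nltM dlo)[h|h]].
  - by move/Eg: h => /(ltM_asym dlo cp).
  - by move: cp; rewrite -h in El *; move/El => /(ltM_irr dlo).
  - by move/El: h => /(ltM_asym dlo cp).
  - by move: cp; rewrite h in Eg *; move/Eg => /(ltM_irr dlo).
have [ce|ec'] := ltM_total dlo (nesym ec); [exists c, e|exists e, c]; split=> // x h h' X DX.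
  apply: contrapT => nX.
  have [|p [dp [h1 h2]]] := cut_dcl DX h; first by move=> E; apply: nX; rewrite E.
  have [+ _] := nolt p dp; apply; split.
    by have [//|e'] := nltM dlo h1; case: nc; rewrite e'.
  by move=> /(ltM_trans dlo h')/h2.
apply: contrapT => nX.
have [|p [dp [h1 h2]]] := cut_dcl DX h'; first by move=> E; apply: nX; rewrite E.
have [_ +] := nolt p dp; apply; split.
  by have [//|e'] := nltM dlo h2; case: nc; rewrite -e'.
by move=> pe; apply: h1; exact: (ltM_trans dlo) h.
Qed.

Hypothesis nontriv : exists x y : M, x <M y.

(** If [a] were not in the closure of [c], the [c]-definable set of points where [th] takes the
    value [c] would contain an interval by [interval_type], and [constant_value] would put [c] in
    the closure of the empty set. *)
Lemma dcl_exchange (a c : M) :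
  dcl [set a] c -> ~ dcl (set0 : set M) c -> dcl [set c] a.
Proof.
move=> /dcl1P[n [th Hth]] nc; apply: contrapT => na; apply: nc.
have [p [q [pq Hpq]]] := interval_type (small1 c) na.
apply: (constant_value pq) => u pu uq.
have [phi Hphi] := def_isval th (ord0 : 'I_2) (lift ord0 ord0).
apply/(Hpq u pu uq [set u | isval th u c]) => //.
exists (@PFormula L M 1 phi (fun _ => c)); split=> //.
by apply/seteqP; split=> z; rewrite /solutions /= Hphi scons0 sconsS.
Qed.

Lemma dcl0_pred D (c : M) : dense_pred D -> dcl (set0 : set M) c -> D c.
Proof.
move=> [dD _ clD] c0; have [x [y /dD[u [_ _ Du]]]] := nontriv.
have /dcl1P[n [th Hth]] : dcl [set u] c by apply: dclS c0.
exact: clD Du Hth.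
Qed.

(** Unless [c] is in the closure of the empty set, triviality provides a single pair [(a, b)] of [G]
    with [c] in the closure of [a]. Exchange moves membership from [c] to [a], [G] moves it to [b],
    and the function giving [c] from [a] moves it to [d]. Only one implication is stated; the other
    comes from the swapped relation. *)
Lemma dcl_respects D D' G (c d : M) : dense_pred D -> dense_pred D' ->
  elementary_rel ((c, d) |` G) -> (forall p, G p -> D p.1 -> D' p.2) ->
  dcl (fst @` G) c -> D c -> D' d.
Proof.
move=> dD dD' eG HG dc Dc.
have Gcd : ((c, d) |` G) (c, d) by left.
have [c0|nc0] := pselect (dcl (set0 : set M) c).
  exact/(dcl0_pred dD')/(elementary_dcl0 eG Gcd).
have [x Gx] : G !=set0.
  by apply/set0P/eqP => G0; apply: nc0; move: dc; rewrite G0 image_set0.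
move: dc; rewrite trivial; last by exists x.1, x.
move=> [_ [[a b] Gab <-] /= ac].
have /dcl1P[n [th Hth]] := dcl_exchange ac nc0.
have Da : D a by case: dD => _ _ cl; apply: cl Dc Hth.
have Db : D' b := HG _ Gab Da.
have /dcl1P[m [th' Hth']] := ac.
have Gab' : ((c, d) |` G) (a, b) by right.
by case: dD' => _ _ cl; apply: cl Db (elementary_isval eG Gab' Gcd Hth').
Qed.

(** If [c] is in the closure of the domain, its image is forced and [dcl_respects] settles the
    predicates. Otherwise the realizations of the transported type contain an interval, in which
    density and codensity of [D'] offer a point on the required side. *)
Lemma partial_iso_forth D D' G c : dense_pred D -> dense_pred D' ->
  card_lt (snd @` G) [set: M] -> partial_iso D D' G ->
  exists d, partial_iso D D' ((c, d) |` G).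
Proof.
move=> dD dD' smallG [eG HG].
suff [d [cd HD]] : exists d, same_type G c d /\ (D c <-> D' d).
  exists d; split; first exact: elementary_relU1.
  by move=> p [->|/HG].
have [dc|ndc] := pselect (dcl (fst @` G) c).
  have [d cd] := dcl_transfer eG dc; exists d; split=> //.
  have eG' := elementary_relU1 cd.
  split; first by apply: dcl_respects eG' _ dc => // p /HG[].
  have eS : elementary_rel ((d, c) |` swap_rel G).
    have -> : (d, c) |` swap_rel G = swap_rel ((c, d) |` G).
      by apply/seteqP; split=> -[x y] /= [[-> ->]|]; by [left|right].
    exact: swap_elementary.
  apply: dcl_respects eS _ _ => //; first by move=> [x y] /HG[].
  apply: same_type_ndcl (swap_same_type cd) _.
  suff -> : snd @` swap_rel G = fst @` G by [].
  by apply/seteqP; split=> _ [[x y] Gxy <-]; exists (y, x).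
have [d0 cd0] := type_transfer c satM eG smallG.
have nd0 : ~ dcl (snd @` G) d0 by move=> /(same_type_ndcl cd0).
have [p [q [pq Hpq]]] := interval_type smallG nd0.
have [d [pd dq HD]] : exists d, [/\ p <M d, d <M q & D c <-> D' d].
  have [dn cdn _] := dD'.
  have [Dc|nDc] := pselect (D c).
    by have [z [? ? ?]] := dn _ _ pq; exists z.
  by have [z [? ? ?]] := cdn _ _ pq; exists z.
exists d; split=> // n phi v Gv; rewrite (cd0 n phi v Gv).
have defS : defset (snd @` G) (solutions (PFormula phi (fun i => (v i).2))).
  by exists (PFormula phi (fun i => (v i).2)); split=> // i; exists (v i).
by have [] := Hpq d pd dq _ defS.
Qed.

End Trivial_geometry.

(** * Back and forth along a well-order *)

Lemma card_le_inj T U (A : set U) : [set: T] #<= A ->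
  exists g : T -> U, injective g /\ forall x, A (g x).
Proof.
move=> /card_leP[f].
exists (fun x => val (f (exist _ x (mem_set I)))); split=> [x y|x]; last exact: set_valP.
move=> /val_inj/(@inj _ _ _ f)-/(_ (mem_set I) (mem_set I)) e.
by case: e.
Qed.

(** If some initial segment of a well-order is as large as [T], let [x0] be the least point with
    such a segment. An injection [f] of [T] into the segment below [x0] pulls back a well-order
    whose initial segments are all small. *)
Lemma small_well_order (T : Type) : exists R : T -> T -> Prop,
  [/\ well_founded R, forall x y, [\/ R x y, x = y | R y x],
      forall y x z, R x y -> R y z -> R x z
    & forall x, card_lt [set y | R y x] [set: T]].
Proof.
have [R0 woR] := well_ordering_principle {classic T}.
pose R (x y : T) := R0 x y /\ x <> y.
have least (A : set T) : A !=set0 -> exists2 z, A z & forall x, A x -> R0 z x.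
  move=> [a Aa]; have [|z [[+ lb] _]] := woR [pred x | `[< A x >]].
    by exists a; apply/asboolP.
  move=> /asboolP Az; exists z => // x Ax; apply: lb.
  exact/asboolP.
(* Antisymmetry comes from uniqueness of the least element of the pair. *)
have uniq2 x y : R0 x y -> R0 y x -> x = y.
  move=> xy yx; have [|z [_ uz]] := woR [pred z | (z == x) || (z == y)].
    by exists x; rewrite inE eqxx.
  have R00 t : R0 t t by have [s -> /(_ t erefl)] := least [set t] (ex_intro _ t erefl).
  have zx : z = x.
    apply: uz; split; first by rewrite inE eqxx.
    by move=> t; rewrite inE => /orP[/eqP->|/eqP->].
  rewrite -zx; apply: uz; split; first by rewrite inE eqxx orbT.
  by move=> t; rewrite inE => /orP[/eqP->|/eqP->].
have tot x y : R0 x y \/ R0 y x.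
  have [|z [->|->] H] := least [set x; y]; first by exists x; left.
    by left; apply: H; right.
  by right; apply: H; left.
have tr y x z : R0 x y -> R0 y z -> R0 x z.
  move=> xy yz; have [|t tE H] := least [set t | [\/ t = x, t = y | t = z]].
    by exists x; apply: Or31.
  have Hx : R0 t x by apply: H; apply: Or31.
  have Hy : R0 t y by apply: H; apply: Or32.
  have Hz : R0 t z by apply: H; apply: Or33.
  case: tE => e; rewrite e in Hx Hy Hz => //.
    by rewrite (uniq2 _ _ xy Hx).
  by rewrite -(uniq2 _ _ yz Hy).
have wfR : well_founded R.
  move=> x; apply: contrapT => nx.
  have [|z nz Hz] := least [set t | ~ Acc R t]; first by exists x.
  apply: nz; apply: Acc_intro => y [yz ne]; apply: contrapT => /Hz zy.
  exact/ne/uniq2.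
have trR y x z : R x y -> R y z -> R x z.
  move=> [xy nxy] [yz nyz]; split; first exact: tr yz.
  by move=> e; apply: nxy; apply: uniq2; rewrite // e.
have [f [injf Hf]] : exists f : T -> T, injective f /\
    forall x, card_lt [set y | R y (f x)] [set: T].
  have small x : ~ ([set: T] #<= [set y | R y x]) -> card_lt [set y | R y x] [set: T].
    by move=> ?; split=> //; exact: card_leT.
  have [[x1 bx1]|nb] := pselect (exists x, [set: T] #<= [set y | R y x]); last first.
    by exists id; split=> // x; apply: small => h; apply: nb; exists x.
  have [|x0 /card_le_inj[f [injf Hf]] lx0] := least [set x | [set: T] #<= [set y | R y x]].
    by exists x1.
  exists f; split=> // x; apply: small => h; have [fx nfx] := Hf x.
  by apply: nfx; apply: uniq2 => //; apply: lx0.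
exists (fun x y => R (f x) (f y)); split.
- exact: Inverse_Image.wf_inverse_image.
- move=> x y; have [->|ne] := pselect (x = y); first by apply: Or32.
  have nf : f x <> f y by move=> /injf.
  by have [h|h] := tot (f x) (f y); [apply: Or31|apply: Or33]; split=> // /esym.
- by move=> y x z; apply: trR.
- move=> x; split; first exact: card_leT.
  move=> h; have [_ +] := Hf x; apply; apply: card_le_trans h _.
  have /card_eqPle[_ le] :
      f @` [set y | R (f y) (f x)] #= [set y | R (f y) (f x)].
    by apply: inj_card_eq => ? ? _ _; exact: injf.
  by apply: card_le_trans le _; apply: subset_card_le => _ [y ? <-].
Qed.

Section Back_and_forth.
Context (T : Type) (good : set (T * T) -> Prop).
Local Notation small A := (card_lt A [set: T]).
Hypothesis smallU : forall A B : set T, small A -> small B -> small (A `|` B).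
Hypothesis small1 : forall a : T, small [set a].
Hypothesis good_chain : forall (D : set T) (F : T -> set (T * T)),
  (forall x y, F x `<=` F y \/ F y `<=` F x) ->
  (forall x, D x -> good (F x)) -> good (\bigcup_(x in D) F x).
Hypothesis forth : forall G c, small (fst @` G) -> small (snd @` G) ->
  good G -> exists d, good ((c, d) |` G).
Hypothesis back : forall G d, small (fst @` G) -> small (snd @` G) ->
  good G -> exists c, good ((c, d) |` G).

Lemma small_le (U : Type) (A : set T) (B : set U) : B #<= A -> small A ->
  ~ ([set: T] #<= B).
Proof. by move=> BA [_ nA] TB; apply: nA; apply: card_le_trans BA. Qed.

(** By recursion along the well-order, stage [x] chooses a pair [F x] whose first component is an
    image of [x] and whose second is a preimage of [x]. Before stage [x] the relation is small,
    because initial segments are. *)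
Lemma back_and_forth : exists G, [/\ good G, forall c, exists d, G (c, d)
  & forall d, exists c, G (c, d)].
Proof.
have [R [wfR totR trR smallR]] := small_well_order T.
pose stage x (F : forall y, R y x -> T * T) := [set p | exists y (h : R y x),
  p = (y, (F y h).1) \/ p = ((F y h).2, y)].
pose ext x (q : T * T) G := (q.2, x) |` ((x, q.1) |` G).
(* The default [(x, x)] is never taken: [goodF] shows by induction that a good extension exists at
   every stage. *)
pose step x F := if pselect (exists q, good (ext x q (stage x F))) is left e
  then sval (cid e) else (x, x).
pose F := Fix wfR (fun _ => (T * T)%type) step.
pose G x := stage x (fun y _ => F y).
have FE x : F x = step x (fun y _ => F y).
  rewrite /F Fix_eq // => {}x f g fg; congr step.
  by apply: functional_extensionality_dep => y; apply: functional_extensionality_dep.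
have GE x : G x = \bigcup_(y in [set y | R y x]) ext y (F y) (G y).
  apply/seteqP; split=> [p [y [h [->|->]]]|p [y yx [->|[->|]]]].
  - by exists y => //; right; left.
  - by exists y => //; left.
  - by exists y, yx; right.
  - by exists y, yx; left.
  - by move=> [z [zy Hz]]; exists z, (trR _ _ _ zy yx).
have GS x y : R x y -> ext x (F x) (G x) `<=` G y.
  by move=> xy p Hp; rewrite GE; exists x.
have chain x y : ext x (F x) (G x) `<=` ext y (F y) (G y) \/
    ext y (F y) (G y) `<=` ext x (F x) (G x).
  have E u v : R u v -> ext u (F u) (G u) `<=` ext v (F v) (G v).
    by move=> /GS H p /H ?; right; right.
  by have [/E|->|/E] := totR x y; [left|left|right].
have small_im x (f : T -> T) : small (f @` [set y | R y x]).
  split; first exact: card_leT.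
  apply: small_le (smallR x); exact: card_image_le.
have small_sub (A B : set T) : A `<=` B -> small B -> small A.
  by move=> AB sB; split; [exact: card_leT|apply: small_le sB; exact: subset_card_le].
have smallG x : small (fst @` G x) /\ small (snd @` G x).
  split.
    apply: (small_sub _ ([set y | R y x] `|` (fun y => (F y).2) @` [set y | R y x])).
      by move=> _ [p [y [h [->|->]]] <-]; [left|right; exists y].
    exact: smallU.
  apply: (small_sub _ ([set y | R y x] `|` (fun y => (F y).1) @` [set y | R y x])).
    by move=> _ [p [y [h [->|->]]] <-]; [right; exists y|left].
  exact: smallU.
have goodF x : good (ext x (F x) (G x)).
  elim/(well_founded_ind wfR): x => x IH.
  have goodG : good (G x) by rewrite GE; apply: good_chain.
  have [s1 s2] := smallG x.
  have [d gd] := forth x s1 s2 goodG.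
  have [||c gc] := @back ((x, d) |` G x) x _ _ gd.
  - apply: (small_sub _ ([set x] `|` (fst @` G x))); last exact: smallU.
    by move=> _ [p [->|Gp] <-]; [left|right; exists p].
  - apply: (small_sub _ ([set d] `|` (snd @` G x))); last exact: smallU.
    by move=> _ [p [->|Gp] <-]; [left|right; exists p].
  rewrite FE /step; case: pselect => [e|[]]; last by exists (d, c).
  exact: (svalP (cid e)).
exists (\bigcup_(x in [set: T]) ext x (F x) (G x)); split.
- exact: good_chain.
- by move=> c; exists (F c).1, c => //; right; left.
- by move=> d; exists (F d).2, d => //; left.
Qed.

End Back_and_forth.

(** * From back and forth to an isomorphism *)

(** The tuple is taken non-empty because [D] may be empty. *)
Lemma chain_tuple T U (D : set T) (F : T -> set U) n (v : 'I_n.+1 -> U) :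
  (forall x y, F x `<=` F y \/ F y `<=` F x) ->
  (forall i, (\bigcup_(x in D) F x) (v i)) ->
  exists2 x, D x & forall i, F x (v i).
Proof.
move=> chain; elim: n v => [|n IH] v Hv.
  by have [x Dx Fx] := Hv ord0; exists x => // i; rewrite (ord1 i).
have [x Dx Fx] := Hv ord0.
have [|y Dy Fy] := IH (fun i => v (lift ord0 i)); first by move=> i; apply: Hv.
have [xy|yx] := chain x y.
  exists y => // i; have [j ->|->] := unliftP ord0 i; [exact: Fy|exact: xy].
exists x => // i; have [j ->|->] := unliftP ord0 i => //; exact/yx/Fy.
Qed.

Lemma partial_iso_chain L (M : structure L) (P D : set M) (I : set M)
    (F : M -> set (M * M)) :
  (forall x y, F x `<=` F y \/ F y `<=` F x) ->
  (forall x, I x -> partial_iso P D (F x)) ->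
  partial_iso P D (\bigcup_(x in I) F x).
Proof.
move=> chain H; split; last by move=> p [x /H[_]]; apply.
move=> [|n] phi v Hv.
  by rewrite (env0_eq (fun i => (v i).1) (fun i => (v i).2)).
by have [x /H[eF _] Fv] := chain_tuple chain Hv; apply: eF.
Qed.

(** Equality of two variables makes [G] the graph of a bijection; the formula equating a variable
    with a function applied to variables gives compatibility with the function symbols. *)
Lemma total_partial_iso L (M : structure L) (P D : set M) (G : set (M * M)) :
  partial_iso P D G -> (forall c, exists d, G (c, d)) ->
  (forall d, exists c, G (c, d)) -> isomorphic (expand P) (expand D).
Proof.
move=> [eG HG] tot1 tot2.
have [h Gh] := choice tot1; have [k Gk] := choice tot2.
have fn c d c' d' : G (c, d) -> G (c', d') -> c = c' <-> d = d'.
  move=> Gcd Gcd'.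
  have := eG _ (FEq (TVar L ord0) (TVar L (lift ord0 ord0)))
    (scons (c, d) (fun _ : 'I_1 => (c', d'))) _.
  rewrite /= scons0 sconsS; apply=> i.
  by rewrite /scons; case: unlift.
exists h; split.
- exists k => x; first exact/(fn _ _ _ _ (Gk (h x)) (Gh x)).
  exact/(fn _ _ _ _ (Gh (k x)) (Gk x)).
- move=> n f v.
  have := eG _ (FEq (TVar L ord0) (@TFun L n.+1 n f (fun i => TVar L (lift ord0 i))))
    (fun i => (scons (finterp f v) v i, h (scons (finterp f v) v i))) _.
  rewrite /= scons0 scons_tail => -[|+ _]; first by move=> i; apply: Gh.
  have -> : (fun i => h (scons (finterp f v) v (lift ord0 i))) = h \o v.
    by apply/funext => i; rewrite sconsS.
  by apply.
- move=> n [{}n r|] v.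
    exact: (eG _ (@FRel L n n r (fun i => TVar L i)) (fun i => (v i, h (v i)))
      (fun i => Gh (v i))).
  exact: (HG _ (Gh (v ord0))).
Qed.

Lemma isomorphism_eval L (M N : structure L) (h : M -> N) n (v : 'I_n -> M)
    (t : term L n) :
  isomorphism h -> h (eval v t) = eval (h \o v) t.
Proof.
move=> [_ hf _]; elim: t => //= k f ts IH; rewrite hf; congr finterp.
by apply/funext => i; apply: IH.
Qed.

Lemma isomorphism_sat L (M N : structure L) (h : M -> N) n (phi : formula L n) :
  isomorphism h -> forall v, sat phi v <-> sat phi (h \o v).
Proof.
move=> ih; have [[k hk kh] _ hr] := ih.
elim: {n} phi => [n|n t u|n m r ts|n p IHp q IHq|n p IHp] v //=.
- by rewrite -!(isomorphism_eval _ _ ih); split=> [->//|/(can_inj hk)].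
- rewrite hr; suff -> : h \o (fun i => eval v (ts i)) = (fun i => eval (h \o v) (ts i)) by [].
  by apply/funext => i; rewrite /= isomorphism_eval.
- by rewrite IHp IHq.
- have E a : h \o scons a v = scons (h a) (h \o v) := scons_comp h a v.
  split=> H a; last by rewrite IHp E.
  by rewrite -(kh a) -E -IHp.
Qed.

Lemma isomorphic_elem_equiv L (M N : structure L) :
  isomorphic M N -> elem_equiv M N.
Proof.
move=> [h ih]; apply/seteqP; rewrite /Th /holds; split=> s /=;
by rewrite (isomorphism_sat s ih) (env0_eq (h \o _) (@env0 N)).
Qed.

(** * Lovely pairs *)

Fixpoint tembed L n (t : term L n) : term (langP L) n :=
  match t with
  | TVar i => TVar (langP L) i
  | TFun _ f ts => @TFun (langP L) n _ f (fun i => tembed (ts i))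
  end.

Fixpoint fembed L n (phi : formula L n) : formula (langP L) n :=
  match phi with
  | FBot n => FBot (langP L) n
  | FEq _ t u => FEq (tembed t) (tembed u)
  | FRel _ _ r ts => @FRel (langP L) _ _ (OldR r) (fun i => tembed (ts i))
  | FImp _ p q => FImp (fembed p) (fembed q)
  | FAll _ p => FAll (fembed p)
  end.

Lemma sat_fembed L (M : structure L) (D : set M) n (phi : formula L n)
    (v : 'I_n -> expand D) : sat (fembed phi) v <-> @sat L M n phi v.
Proof.
have E m (w : 'I_m -> expand D) (t : term L m) : eval w (tembed t) = @eval L M m w t.
  by elim: t => //= k f ts IH; congr finterp; apply/funext.
elim: {n} phi v => [n|n t u|n k r ts|n p IHp q IHq|n p IHp] v //=.
- by rewrite !E.
- by under eq_fun do rewrite E.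
- by rewrite IHp IHq.
- by split=> H a; have := H a; rewrite IHp.
Qed.

Definition in_pred L (K : structure (langP L)) (x : K) :=
  rinterp (PredP L : rsym (langP L) 1) (fun _ => x).

Lemma def_in_pred L n (i : 'I_n) :
  definable (fun (K : structure (langP L)) v => in_pred (v i)).
Proof. exact: (def_rel (PredP L : rsym (langP L) 1) (fun _ => i)). Qed.

Lemma expand_isval L (M : structure L) (D : set M) n (th : formula L n.+1)
    (u y : M) :
  @isval _ _ (fembed th) (expand D) u y <-> isval th u y.
Proof. by split=> H z; have := H z; rewrite sat_fembed. Qed.

(** Elementarity first gives the function a value at [u] inside [Q], then shows that this is also
    its value in [N], namely [y]. *)
Lemma elementary_substructure_isval L (N : structure L) (Q : set N) n
    (th : formula L n.+1) u y :
  elementary_substructure Q -> Q u -> isval th u y -> Q y.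
Proof.
move=> [hQ eQ] Qu uy.
pose u' : substructure hQ := exist _ u (mem_set Qu).
have [phi Hphi] : definable (fun (K : structure L) (w : 'I_1 -> K) =>
    exists z, isval th (w ord0) z) by apply/def_ex/def_isval.
have /Hphi[y' uy'] : sat phi (fun _ => u').
  by apply/eQ/Hphi; exists y.
have [psi Hpsi] := def_isval th (ord0 : 'I_2) (lift ord0 ord0).
have := eQ _ psi (scons u' (fun _ => y')).
rewrite !Hpsi !scons0 !sconsS => -[/(_ uy') uy'' _].
suff -> : y = val y' by apply: set_valP.
by apply/uy''; apply/uy.
Qed.

Section Lovely_pairs.
Context (L : language) (lt : rsym L 2) (N : structure L) (Q : set N).
Hypothesis dlo : dense_linear_order lt N.
Local Notation "x <M y" := (ltM lt x y) (at level 70).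

(** The type of points immediately to the right of [x]: an ultrafilter containing every interval
    from [x] to a point [z] above [x] and not beyond [y]. A finite set misses one of these
    intervals, so the type is non-algebraic. *)
Lemma nonalgebraic_in_interval (x y : N) : x <M y ->
  exists q : set (pformula N), [/\ type_over [set x; y] q, nonalgebraic q
    & forall a, realizes q a -> x <M a /\ a <M y].
Proof.
move=> xy; pose I := [set z | x <M z /\ ~ y <M z].
pose B z := [set t | x <M t /\ t <M z].
have PF : ProperFilter (filter_from I B).
  apply: filter_from_proper; last first.
    by move=> z [/(ltM_dense dlo)[t [xt tz]] _]; exists t.
  apply: filter_from_filter; first by exists y; split=> //; apply: ltM_irr.
  move=> z z' Iz Iz'; have [zz'|] := pselect (z <M z').
    by exists z => // t [xt tz]; split=> //; split=> //; apply: (ltM_trans dlo) zz'.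
  move=> nzz'; exists z' => // t [xt tz]; split=> //; split=> //.
  exact: (ltM_le_trans dlo) nzz'.
have [U [UU FU]] := ultraFilterLemma PF.
exists [set phi | over [set x; y] phi /\ U (solutions phi)]; split.
- exact: ultra_type_over.
- move=> phi [_ Uphi] /(@finite_seqP {classic N})[s sE].
  have [z Iz Hz] : exists2 z, I z & forall t : {classic N}, B z t -> t \notin s.
    elim: s {sE} => [|a s [z Iz Hz]]; first by exists y => //; split=> //; apply: ltM_irr.
    have [[xa az]|na] := pselect (B z a).
      exists a; first by split=> // ya; case: Iz => _; apply; apply: (ltM_trans dlo) az.
      move=> t [xt ta]; rewrite in_cons negb_or Hz ?andbT.
        by apply/eqP => e; rewrite e in ta; apply: ltM_irr ta.
      by split=> //; apply: (ltM_trans dlo) az.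
    exists z => // t Bt; rewrite in_cons negb_or Hz ?andbT //.
    by apply/eqP => e; apply: na; rewrite -e.
  have PU : ProperFilter U by apply: ultra_proper.
  have UB : U (B z) by apply: FU; exists z.
  have [t [+ /Hz]] := filter_ex (filterI Uphi UB).
  by rewrite sE /= => ->.
have UB : U (B y) by apply: FU; exists y => //; split=> //; apply: ltM_irr.
have PU : ProperFilter U by apply: ultra_proper.
move=> a ra; split.
  have [phi [ophi E]] : defset [set x; y] [set t | x <M t] by apply: defset_ltl; left.
  suff : solutions phi a by rewrite E.
  by apply: ra; split=> //; rewrite E; apply: filterS UB => t [].
have [phi [ophi E]] : defset [set x; y] [set t | t <M y] by apply: defset_ltr; right.
suff : solutions phi a by rewrite E.
by apply: ra; split=> //; rewrite E; apply: filterS UB => t [].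
Qed.

(** The coheir property gives density. The extension property gives codensity, since each point of
    [Q] is algebraic over [Q]. *)
Lemma lovely_dense_pred (T : set (sentence L)) : lovely_pair T Q -> dense_pred lt Q.
Proof.
move=> [_ eQ coheir ext]; split.
- move=> x y /nonalgebraic_in_interval[q [tq nq Hq]].
  have [a ra Qa] := coheir _ q (finite_set2 x y) tq nq.
  by have [? ?] := Hq a ra; exists a.
- move=> x y /nonalgebraic_in_interval[q [tq nq Hq]].
  have [a ra na] := ext _ q (finite_set2 x y) tq nq.
  have [? ?] := Hq a ra; exists a; split=> // Qa; apply: na.
  have [phi [ophi E]] : defset ([set x; y] `|` Q) [set a] by apply: defset1; right.
  by exists phi; rewrite E; split=> //; apply: finite_set1.
- move=> n th u y; exact: elementary_substructure_isval.
Qed.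

End Lovely_pairs.

(** Each clause is expressed by sentences true in all lovely pairs. They belong to
    [lovely_theory T], so they hold in [expand P] and then in [expand D]. *)
Lemma lovely_theory_dense_pred L lt (T : set (sentence L)) (M : structure L)
    (P D : set M) :
  (forall (N : structure L) (Q : set N), lovely_pair T Q -> dense_pred lt Q) ->
  model (lovely_theory T) (expand P) -> elem_equiv (expand P) (expand D) ->
  dense_pred lt D.
Proof.
move=> lovely mP PD.
have key (R : structure (langP L) -> Prop) :
    definable (fun K (_ : 'I_0 -> K) => R K) ->
    (forall (N : structure L) (Q : set N), dense_pred lt Q -> R (expand Q)) ->
    R (expand D).
  move=> /def_closure[s Hs] HR; have [H _] := Hs (expand D).
  apply: (H _ (@env0 (expand D))).
  have -> : holds (expand D) s = Th (expand D) s by [].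
  by rewrite -PD; apply: mP => N Q /lovely dQ; apply/Hs => _; apply: HR.
pose ltP : rsym (langP L) 2 := OldR lt.
split.
- move=> x y xy; have [|N Q [dQ _ _]|z [? []]] := key (fun K => forall x y : K,
    ltM ltP x y -> exists z, ltM ltP x z /\ ltM ltP z y /\ in_pred z) _ _ x y xy.
  + do 2 apply: def_all; apply: def_imp; first exact: def_lt.
    apply/def_ex/def_and; first exact: def_lt.
    by apply: def_and; [exact: def_lt|exact: def_in_pred].
  + by move=> a b /dQ[z []]; exists z.
  + by exists z.
- move=> x y xy; have [|N Q [_ cQ _]|z [? []]] := key (fun K => forall x y : K,
    ltM ltP x y -> exists z, ltM ltP x z /\ ltM ltP z y /\ ~ in_pred z) _ _ x y xy.
  + do 2 apply: def_all; apply: def_imp; first exact: def_lt.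
    apply/def_ex/def_and; first exact: def_lt.
    by apply: def_and; [exact: def_lt|apply: def_not; exact: def_in_pred].
  + by move=> a b /cQ[z []]; exists z.
  + by exists z.
move=> n th u y Du /(expand_isval D) uy.
have : forall u y : expand D, in_pred u -> isval (fembed th) u y -> in_pred y.
  apply: (key (fun K => forall u y : K, in_pred u -> isval (fembed th) u y -> in_pred y)).
    apply/def_all/def_all/def_imp; first exact: def_in_pred.
    by apply: def_imp; [exact: def_isval|exact: def_in_pred].
  by move=> N Q [_ _ cl] a b Qa /expand_isval; apply: cl.
by move=> H; exact: (H u y Du uy).
Qed.

(** * Transfer of the two consequences of o-minimality *)

Section O_minimal_transfer.
Context (L : language) (lt : rsym L 2) (M0 M : structure L).
Hypothesis om : o_minimal lt M0.
Hypothesis MM : model (Th M0) M.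

Lemma boundary_transfer (phi : pformula M) : has_boundary lt (solutions phi).
Proof.
case: phi => n f p.
have [|+ _] := @transfer _ M0 M n (fun N v => has_boundary lt
  (fun x => sat f (scons x (fun i => v i)))) MM.
  by rewrite /has_boundary /left_end /right_end; definability.
apply=> v; have [dlo _] := om.
have [s] := o_minimal_const_off dlo (PFormula f v) om.
exact: has_boundary_const_off.
Qed.

(** An interval in [R M0] would give one in [R M]. The bound [k] found in [M0] is then a fixed
    number, so the statement that no point reaches rank [k] is first-order and passes to [M]. *)
Lemma ranked_transfer (R : forall N : structure L, N -> Prop) :
  definable (fun N (w : 'I_1 -> N) => R N (w ord0)) ->
  ~ has_interval lt (R M) -> exists k, forall y, ~ rank_ge lt (R M) k y.
Proof.
move=> defR noI.
have noI0 : ~ has_interval lt (R M0).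
  have [|+ _] := @transfer _ M0 M 0 (fun N _ => has_interval lt (R N)) MM.
    rewrite /has_interval; apply/def_ex/def_ex/def_and; first exact: def_lt.
    apply/def_all/def_imp; first exact: def_lt.
    apply/def_imp; first exact: def_lt.
    exact: (def_subst (fun _ => ord0) defR).
  by move=> H h; apply: noI; apply: (H (fun _ => h) (@env0 M)).
have [phi Hphi] := defR.
have [dlo _] := om.
have [s cs] := o_minimal_const_off dlo (@PFormula L M0 0 phi (@env0 M0)) om.
have E : solutions (@PFormula L M0 0 phi (@env0 M0)) = R M0.
  by apply/funext => x; apply/propext; rewrite /solutions /= Hphi scons0.
rewrite E in cs.
have [k Hk] := rank_bounded dlo cs noI0; exists k => y.
have [+ _] := transfer MM (def_not (def_rank_ge lt k defR)).
by move=> H; apply: (H (fun v => Hk (v ord0)) (fun _ => y)).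
Qed.

End O_minimal_transfer.

(** * Small sets below an inaccessible cardinal *)

Section Small.
Context (Lam T : Type).
Hypothesis hLam : strongly_inaccessible Lam.
Hypothesis TLam : [set: T] #= [set: Lam].

Lemma inaccessible_infinite : infinite_set [set: T].
Proof.
have [[h _] _ _] := hLam; apply/infiniteP.
by move/card_eqPle: TLam => [_]; apply: card_le_trans.
Qed.

Lemma small_finite (U : Type) (A : set U) : finite_set A -> card_lt A [set: T].
Proof.
move=> fA; split; last first.
  by move=> /card_le_finite/(_ fA)/inaccessible_infinite.
have /infiniteP := inaccessible_infinite; apply: card_le_trans.
exact: finite_set_countable.
Qed.

(** The union is copied into [Lam] by an injection [g] and indexed by the two points [e 0] and
    [e 1], so that regularity applies. *)
Lemma small_setU (A B : set T) :
  card_lt A [set: T] -> card_lt B [set: T] -> card_lt (A `|` B) [set: T].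
Proof.
move=> [_ nA] [_ nB]; split; first exact: card_leT.
have [[h _] bigc _] := hLam.
have [TL LT] : [set: T] #<= [set: Lam] /\ [set: Lam] #<= [set: T].
  exact/card_eqPle.
have [g [injg _]] := card_le_inj TL; have [e [inje _]] := card_le_inj h.
pose F i := if `[< i = e 0%N >] then g @` A else g @` B.
have [||_ nL] := bigc [set e 0%N; e 1%N] F.
- split; first exact: card_leT.
  move=> LI; apply: inaccessible_infinite.
  by apply: card_le_finite (finite_set2 (e 0%N) (e 1%N)); apply: card_le_trans LI.
- move=> i _; split; first exact: card_leT.
  rewrite /F; case: asboolP => _ LF; [apply: nA|apply: nB];
  by apply: card_le_trans TL _; apply: card_le_trans LF _; apply: card_image_le.
move=> TAB; apply: nL; apply: card_le_trans LT _; apply: card_le_trans TAB _.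
have /card_eqPle[_ le] : g @` (A `|` B) #= A `|` B.
  by apply: inj_card_eq => ? ? _ _; exact: injg.
apply: card_le_trans le _; apply: subset_card_le => _ [x [Ax|Bx] <-].
  by exists (e 0%N); [left|rewrite /F asboolT //; exists x].
exists (e 1%N); [by right|rewrite /F asboolF; first by exists x].
by move=> /inje.
Qed.

End Small.

Theorem proposition5p10 (Lam : Type) (L : language) (lt : rsym L 2)
    (T : set (sentence L)) (M : structure L) (P : set M)
    (hLam : strongly_inaccessible Lam)
    (hL : card_lt [set: symbols L] [set: Lam])
    (hT : o_minimal_theory lt T)
    (hTinf : has_infinite_model T)
    (hM : monster Lam T M)
    (hdcl : forall A : set M, A !=set0 -> dcl A = \bigcup_(a in A) dcl [set a])
    (hMP : monster Lam (lovely_theory T) (expand P)) :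
  iso_class P = elem_class P.
Proof.
apply/seteqP; split=> D; first exact: isomorphic_elem_equiv.
move=> PD; have [M0 [om TE]] := hT; have [dlo0 _] := om.
have [modM satM cardM] := hM; have [modMP _ _] := hMP.
have MM : model (Th M0) M by rewrite -TE.
have dlo := dlo_transfer MM dlo0.
have lovely (N : structure L) (Q : set N) : lovely_pair T Q -> dense_pred lt Q.
  move=> lNQ; apply: lovely_dense_pred (lNQ); apply: dlo_transfer dlo0.
  by rewrite -TE; case: lNQ.
have dP : dense_pred lt P by exact: lovely_theory_dense_pred lovely modMP erefl.
have dD : dense_pred lt D by exact: lovely_theory_dense_pred lovely modMP PD.
have smallU := small_setU hLam cardM.
have small1 (a : M) : card_lt [set a] [set: M].
  exact/(small_finite hLam cardM)/finite_set1.
have nontriv : exists x y : M, ltM lt x y.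
  apply: contrapT => noxy; apply: (inaccessible_infinite hLam cardM).
  have [->|/set0P[a _]] := eqVneq [set: M] set0; first exact: finite_set0.
  apply: sub_finite_set (finite_set1 a) => x _; apply: contrapT.
  by move=> /(ltM_total dlo)[h|h]; apply: noxy; [exists x, a|exists a, x].
have forth P1 D1 := @partial_iso_forth L lt M dlo (boundary_transfer om MM)
  (ranked_transfer om MM) hdcl satM smallU small1 P dP nontriv P1 D1.
have [| | |G [isoG tot1 tot2]] := @back_and_forth M (partial_iso P D) smallU small1.
- exact: partial_iso_chain.
- by move=> G c _ sG; apply: forth.
(* The back step is the forth step for the swapped relation, with [P] and [D] exchanged. *)
- move=> G d sG _ /swap_partial_iso isoG.
  have [|c /swap_partial_iso isoc] := forth D P (swap_rel G) d dD dP _ isoG.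
    suff -> : snd @` swap_rel G = fst @` G by [].
    by apply/seteqP; split=> _ [[x y] Gxy <-]; exists (y, x).
  exists c; suff <- : swap_rel ((d, c) |` swap_rel G) = (c, d) |` G by [].
  by apply/seteqP; split=> -[x y] /= [[-> ->]|]; by [left|right].
exact: total_partial_iso tot1 tot2.
Qed.
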